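(* Let a set $X$ of cycles be called a cycle obstruction set for unbalanced $2$-partitionability if there exists a nonnegative integer $D$ such that every planar graph containing none of the cycles in $X$ as a subgraph is $(0,D)$-colorable. Then the inclusion-wise minimal cycle obstruction sets for unbalanced $2$-partitionability are exactly $\{C_{2i+1} : i \ge 1\}$ (the set of all odd cycles) and $\{C_3, C_4, C_6\}$.
   Context: All graphs are finite and simple. $C_k$ denotes the cycle of length $k$; cycles are considered up to isomorphism. For nonnegative integers $k,d_1,\dots,d_k$, a graph is $(d_1,\dots,d_k)$-colorable if its vertex set can be partitioned into $k$ parts $V_1,\dots,V_k$ such that $V_i$ induces a subgraph of maximum degree at most $d_i$ for every $i$. A class of graphs is unbalanced $k$-partitionable if there is a nonnegative integer $D$ such that every graph in the class is $(0,\dots,0,D)$-colorable (tuple of length $k$). A set $X$ of cycles is a cycle obstruction set of a class $\mathcal C$ of planar graphs if every planar graph containing no cycle of $X$ as a subgraph belongs to $\mathcal C$. *)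

(* Defs.v *)
From HB Require Import structures.
From mathcomp Require Import all_boot all_order all_algebra.
From mathcomp Require Import boolp classical_sets reals.

Set Implicit Arguments.
Unset Strict Implicit.
Unset Printing Implicit Defensive.

Import Order.TTheory GRing.Theory Num.Theory.
Local Open Scope classical_set_scope.

Record sgraph := SGraph {
  vertex :> finType;
  adj : rel vertex;
  adj_sym : symmetric adj;
  adj_irrefl : irreflexive adj }.

Arguments adj {s}.

(* Not necessarily induced. *)
Definition has_subgraph (G H : sgraph) : Prop :=
  exists2 f : H -> G, injective f & forall x y, adj x y -> adj (f x) (f y).

Section CycleGraph.
Variable k : nat.

Definition cycle_adj : rel 'I_k :=
  [rel i j | (i != j) && ((ordS i == j) || (ordS j == i))].

Lemma cycle_adj_sym : symmetric cycle_adj.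
Proof. by move=> i j; rewrite /cycle_adj /= eq_sym orbC. Qed.

Lemma cycle_adj_irrefl : irreflexive cycle_adj.
Proof. by move=> i; rewrite /cycle_adj /= eqxx. Qed.

(* This is the cycle C_k only for 3 <= k. *)
Definition cycle_graph : sgraph := SGraph cycle_adj_sym cycle_adj_irrefl.

End CycleGraph.

(* A coloring c encodes the partition into the parts V_i := c^-1(i), which may
   be empty. *)
Definition colorable (k : nat) (d : k.-tuple nat) (G : sgraph) : Prop :=
  exists c : G -> 'I_k, forall (i : 'I_k) (v : G), c v = i ->
    #|[pred w : G | adj v w && (c w == i)]| <= tnth d i.

(* Planarity follows Diestel, Graph Theory, Section 4.2: edges of a plane graph
   are drawn as simple polygonal arcs in the real plane. *)
Section Planar.
Variable R : realType.
Local Open Scope ring_scope.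

Definition plane : Type := R * R.

Definition segment (p q : plane) : set plane :=
  [set z | exists2 t : R, 0 <= t <= 1 &
     z = ((1 - t) * p.1 + t * q.1, (1 - t) * p.2 + t * q.2)].

(* The arc has the n + 1 segments [p 0, p 1], ..., [p n, p (n + 1)]; the values
   of p beyond n + 1 are irrelevant. *)
Definition polygonal_arc (P : set plane) (a b : plane) : Prop :=
  exists (n : nat) (p : nat -> plane),
    [/\ p 0%N = a /\ p n.+1 = b,
        forall i, (i <= n)%N -> p i <> p i.+1,
        forall i, (i < n)%N ->
          segment (p i) (p i.+1) `&` segment (p i.+1) (p i.+2)
            = [set p i.+1],
        forall i j, (i.+1 < j <= n)%N ->
          segment (p i) (p i.+1) `&` segment (p j) (p j.+1) = set0 &
        P = \bigcup_(i in [set i | (i <= n)%N]) segment (p i) (p i.+1)].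

(* The edge joining x and y is represented by the pair [set x; y]. *)
Definition plane_drawing (G : sgraph)
    (pos : G -> plane) (arc : {set G} -> set plane) : Prop :=
  let interior x y := arc [set x; y]%SET `\` [set pos x; pos y] in
  [/\ injective pos,
      forall x y, adj x y -> polygonal_arc (arc [set x; y]%SET) (pos x) (pos y),
      forall x y z, adj x y -> ~ interior x y (pos z) &
      forall x y x' y', adj x y -> adj x' y' ->
        [set x; y]%SET <> [set x'; y']%SET ->
        interior x y `&` arc [set x'; y']%SET = set0].

Definition planar (G : sgraph) : Prop :=
  exists (pos : G -> plane) (arc : {set G} -> set plane), plane_drawing pos arc.

End Planar.

(* A set of cycles, taken up to isomorphism, is encoded by the set of the
   lengths of its members. *)
Definition cycle_set (X : set nat) : Prop := X `<=` [set k | 3 <= k].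

Definition cycle_obstruction_set (R : realType) (X : set nat) : Prop :=
  cycle_set X /\
  exists D : nat, forall G : sgraph, planar R G ->
    (forall k, X k -> ~ has_subgraph G (cycle_graph k)) ->
    colorable [tuple 0; D] G.

Definition minimal_cycle_obstruction_set (R : realType) (X : set nat) : Prop :=
  cycle_obstruction_set R X /\
  forall Y : set nat, Y `<=` X -> cycle_obstruction_set R Y -> Y = X.

(* Main.v *)
(* The families not containing an odd cycle C_l and one of C_3, C_4, C_6 are not
   obstruction sets: blow up vertices of C_l so that its only further cycles are
   C_4 (parallel paths of length 2) or C_6 (parallel paths of length 3). Many
   parallel paths of length 2 force one end into the independent part as soon as
   the other is in it, and many of length 3 forbid that both ends lie outside.
   Going around C_l, this forces the colour of one vertex, and joining copies at
   this vertex by bridges leaves no colouring. These graphs have two-page book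
   embeddings.

   Conversely, a planar graph without C_3, C_4, C_6 that is minimal among those
   that are not (0,40)-colourable has minimum degree 2, and all its vertices of
   degree at most 41 have a neighbour of degree at least 42. Faces have length 5 or
   at least 7, and the two faces at a vertex of degree 2 are not both pentagons,
   since these would form a C_6. Discharging then contradicts Euler's inequality
   E + 1 <= V + F for the faces traced by the rotation system of a drawing. That
   inequality is linear algebra over F_2: the incidence matrix of edges and
   vertices has rank less than V, and its kernel, the even edge sets, is spanned by
   the boundaries of the F faces, because an even edge set Z is the boundary of the
   faces on which the parity of the number of crossings with Z is odd. *)

Require Import Defs.
From mathcomp Require Import all_boot all_order all_algebra.
From mathcomp Require Import boolp classical_sets reals.
From mathcomp Require Import zify ring lra.
(* Reimported because [classical_sets] shadows lemma names of [finset]. *)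
From mathcomp Require Import fintype finset.

Set Implicit Arguments.
Unset Strict Implicit.
Unset Printing Implicit Defensive.

Import Order.TTheory GRing.Theory Num.Theory.

(** * Euler's inequality for rotation systems *)

Definition deg (G : sgraph) (x : G) := #|[pred y | adj x y]|.

Definition oriented (G : sgraph) : pred (G * G) :=
  [pred e | adj e.1 e.2 && (enum_rank e.1 < enum_rank e.2)].
Arguments oriented : clear implicits.

Lemma big_oriented (T : Type) (idx : T) (op : Monoid.com_law idx)
    (G : sgraph) (F : G -> G -> T) :
  (forall x y, ~~ adj x y -> F x y = idx) ->
  \big[op/idx]_x \big[op/idx]_y F x y =
  \big[op/idx]_(e | oriented G e) op (F e.1 e.2) (F e.2 e.1).
Proof.
move=> F_nonadj; rewrite pair_big /= big_split /=.
rewrite (bigID (oriented G)) /=; congr (op _ _).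
rewrite [RHS](reindex (fun e : G * G => (e.2, e.1))) /=; last first.
  by exists (fun e : G * G => (e.2, e.1)) => -[].
rewrite big_mkcond [RHS]big_mkcond /=; apply: eq_bigr => -[x y] _ /=.
rewrite /oriented /= [adj y x]adj_sym.
case: (boolP (adj x y)) => [axy|/F_nonadj->] //=.
case: ltngtP => // /val_inj/enum_rank_inj xy.
by move: axy; rewrite xy adj_irrefl.
Qed.

Lemma big_oriented_at (T : Type) (idx : T) (op : Monoid.com_law idx)
    (G : sgraph) (x : G) (F : G -> T) :
  (forall y, ~~ adj x y -> F y = idx) ->
  \big[op/idx]_y F y =
  \big[op/idx]_(e | oriented G e)
    op (if e.1 == x then F e.2 else idx) (if e.2 == x then F e.1 else idx).
Proof.
move=> F_nonadj.
rewrite -(@big_oriented _ _ op G (fun z y => if z == x then F y else idx)).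
  rewrite [RHS](bigD1 x) //= eqxx [X in op _ X]big1 ?Monoid.mulm1 //.
  by move=> y /negPf->; apply: big1.
by move=> z y; case: eqP => // -> /F_nonadj.
Qed.

Lemma handshake (G : sgraph) : \sum_(x : G) deg x = #|oriented G|.*2.
Proof.
under eq_bigr do rewrite /deg -sum1_card big_mkcond /=.
rewrite (@big_oriented _ _ addn) => [|x y]; last by rewrite inE => /negPf->.
rewrite -muln2 -sum1_card big_distrl /=.
apply: eq_bigr => -[x y] /andP[/= axy _].
by rewrite !inE [adj y x]adj_sym axy.
Qed.

Record rotation_system (G : sgraph) := RotationSystem {
  cyclic_nbrs :> G -> seq G;
  cyclic_nbrs_uniq : forall x, uniq (cyclic_nbrs x);
  mem_cyclic_nbrs : forall x y, (y \in cyclic_nbrs x) = adj x y }.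

Definition degree_parity (G : sgraph) (Z : rel G) (x : G) : bool :=
  \big[addb/false]_y Z x y.

Definition even_edge_set (G : sgraph) (Z : rel G) : Prop :=
  [/\ symmetric Z, subrel Z adj & forall x, degree_parity Z x = false].

(* Every even edge set is the boundary of a set of faces; this is what planarity
   provides. [W x y] tells whether the face of the dart from [x] to [y] is in that
   set. *)
Definition separating (G : sgraph) (s : rotation_system G) : Prop :=
  forall Z : rel G, even_edge_set Z -> exists W : rel G,
    (forall x y, adj x y -> W x y (+) W y x = Z x y) /\
    (forall x y, adj x y -> W y (prev (s y) x) = W x y).

Section Darts.
Variable G : sgraph.

Definition dart := {d : G * G | adj d.1 d.2}.

Definition make_dart x y (axy : adj x y) : dart :=
  exist (fun d : G * G => adj d.1 d.2) (x, y) axy.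

Fact reverse_subproof (d : dart) : adj (val d).2 (val d).1.
Proof. by rewrite adj_sym; apply: (valP d). Qed.

Definition reverse (d : dart) : dart := make_dart (reverse_subproof d).

Lemma card_dart : #|{: dart}| = #|oriented G|.*2.
Proof.
rewrite -handshake card_sig /deg.
under eq_bigr do rewrite -sum1_card.
rewrite pair_big_dep /= sum1_card.
by apply: eq_card => -[x y]; rewrite !inE.
Qed.

End Darts.

Section Faces.
Variables (G : sgraph) (s : rotation_system G).
Local Notation dart := (dart G).

Fact face_next_subproof (d : dart) :
  adj (val d).2 (prev (s (val d).2) (val d).1).
Proof.
rewrite -(mem_cyclic_nbrs s) mem_prev mem_cyclic_nbrs adj_sym.
exact: (valP d).
Qed.

Definition face_next (d : dart) : dart := make_dart (face_next_subproof d).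

Lemma face_next_inj : injective face_next.
Proof.
move=> [[x y] axy] [[x' y'] axy'] /(congr1 val) [/= yy' prevE].
rewrite -{}yy' in axy' prevE *; apply: val_inj => /=; congr (_, _).
exact: can_inj (next_prev (cyclic_nbrs_uniq s y)) _ _ prevE.
Qed.

Lemma face_connect_sym : connect_sym (frel face_next).
Proof. by apply: fconnect_sym; apply: face_next_inj. Qed.

Lemma froot_face_invariant (T : Type) (F : dart -> T) :
  (forall d, F (face_next d) = F d) -> forall d, F (froot face_next d) = F d.
Proof.
move=> F_next d; have F_iter n : F (iter n face_next d) = F d.
  by elim: n => //= n <-; apply: F_next.
by rewrite -(iter_findex (connect_root (frel face_next) d)).
Qed.

End Faces.

Section EulerInequality.
Local Open Scope ring_scope.

Lemma F2_natr (a : 'F_2) : a = (a != 0)%:R.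
Proof. by case: a => -[|[|//]] lt2; apply: val_inj. Qed.

Lemma F2_natr_inj : injective (fun b : bool => b%:R : 'F_2).
Proof. by case=> -[]. Qed.

Lemma F2_natr_addb : {morph (fun b : bool => b%:R : 'F_2) : a b / a (+) b >-> a + b}.
Proof. by case=> -[]; apply: val_inj. Qed.

Variables (G : sgraph) (s : rotation_system G).

Definition incidence : 'M['F_2]_(#|oriented G|, #|G|) :=
  \matrix_(i, j)
    (((enum_val i).1 == enum_val j)%:R + ((enum_val i).2 == enum_val j)%:R).

Lemma rank_incidence : (0 < #|G|)%N -> (\rank incidence < #|G|)%N.
Proof.
move=> G_gt0; pose ones : 'cV['F_2]_#|G| := const_mx 1.
have rank_ones : (0 < \rank ones)%N.
  rewrite lt0n mxrank_eq0; apply/eqP => /matrixP/(_ (Ordinal G_gt0) ord0).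
  by rewrite !mxE => /eqP; rewrite oner_eq0.
suff /mulmx0_rank_max : incidence *m ones = 0.
  by apply: leq_trans; rewrite -addn1 leq_add2l.
have sum_delta (x : G) : \sum_(j < #|G|) (x == enum_val j)%:R = 1 :> 'F_2.
  rewrite -(big_enum_val (fun y => (x == y)%:R)) (bigD1 x) //= eqxx big1 ?addr0 //.
  by move=> y; rewrite eq_sym => /negPf->.
apply/matrixP => i k; rewrite !mxE.
under eq_bigr do rewrite !mxE mulr1.
by rewrite big_split /= !sum_delta; apply: val_inj.
Qed.

Definition edge_dart (i : 'I_#|oriented G|) : dart G :=
  exist _ (enum_val i) (proj1 (andP (enum_valP i))).

Local Notation face := (froot (face_next s)).
Local Notation faces := (froots (face_next s)).

Definition face_incidence : 'M['F_2]_(#|faces|, #|oriented G|) :=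
  \matrix_(r, i) ((face (edge_dart i) == enum_val r)%:R +
                  (face (reverse (edge_dart i)) == enum_val r)%:R).

Lemma mul_face_incidence (W : dart G -> 'F_2) i : (forall d, W (face_next s d) = W d) ->
  ((\row_r W (enum_val r)) *m face_incidence) 0 i =
  W (edge_dart i) + W (reverse (edge_dart i)).
Proof.
move=> W_next; rewrite mxE.
under eq_bigr do rewrite !mxE mulrDr.
have pick_face d : \sum_(r < #|faces|) W (enum_val r) * (face d == enum_val r)%:R = W d.
  rewrite -(big_enum_val (fun r => W r * (face d == r)%:R)) /=.
  have faces_d : face d \in faces by apply: roots_root; apply: face_connect_sym.
  rewrite (bigD1 (face d)) //= eqxx mulr1 froot_face_invariant // big1 ?addr0 //.
  by move=> r /andP[_ /negPf]; rewrite eq_sym => ->; rewrite mulr0.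
by rewrite big_split /= !pick_face.
Qed.

Definition edge_support (u : 'rV['F_2]_#|oriented G|) : rel G := fun x y =>
  [exists i, (u 0 i != 0) && ((enum_val i == (x, y)) || (enum_val i == (y, x)))].

Lemma edge_support_sym u : symmetric (edge_support u).
Proof. by move=> x y; apply: eq_existsb => i; rewrite orbC. Qed.

Lemma edge_support_adj u : subrel (edge_support u) adj.
Proof.
move=> x y /existsP[i /andP[_ iE]]; have /andP[] := enum_valP i.
by case/orP: iE => /eqP->; rewrite //= adj_sym.
Qed.

Lemma edge_support_enum_val u i :
  edge_support u (enum_val i).1 (enum_val i).2 = (u 0 i != 0).
Proof.
apply/existsP/idP => [[j /andP[uj]]|ui]; last first.
  by exists i; rewrite ui -surjective_pairing eqxx.
rewrite -surjective_pairing => /orP[/eqP/enum_val_inj <-//|/eqP rev].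
have /andP[_] := enum_valP i; have /andP[_] := enum_valP j.
by rewrite rev /= => /ltn_trans lt /lt; rewrite ltnn.
Qed.

Lemma kermx_even_edge_set u : u *m incidence = 0 -> even_edge_set (edge_support u).
Proof.
move=> u_ker; split; [exact: edge_support_sym | exact: edge_support_adj|] => x.
have -> : degree_parity (edge_support u) x =
    \big[addb/false]_(e in oriented G)
      (((e.1 == x) (+) (e.2 == x)) && edge_support u e.1 e.2).
  rewrite /degree_parity (@big_oriented_at _ _ _ G x); last first.
    by move=> y; apply: contraNF; apply: edge_support_adj.
  apply: eq_bigr => e _; case: eqP => [->|_]; case: eqP => [->|_] //=.
  - by rewrite !addbb.
  - by rewrite addbF.
  - by rewrite edge_support_sym.
apply: F2_natr_inj; rewrite (big_morph _ F2_natr_addb (erefl : false%:R = 0)).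
have /rowP/(_ (enum_rank x)) := u_ker; rewrite !mxE => ker_x.
apply: etrans ker_x; rewrite (big_enum_val
  (fun e => (((e.1 == x) (+) (e.2 == x)) && edge_support u e.1 e.2)%:R)).
apply: eq_bigr => i _; rewrite edge_support_enum_val mxE enum_rankK -F2_natr_addb.
by rewrite andbC -mulnb natrM -F2_natr.
Qed.

Lemma kermx_incidence : separating s -> (kermx incidence <= face_incidence)%MS.
Proof.
move=> sep; apply/rV_subP => u /sub_kermxP u_ker.
have [W [W_boundary W_face]] := sep _ (kermx_even_edge_set u_ker).
pose inside (d : dart G) : 'F_2 := (W (val d).1 (val d).2)%:R.
apply/submxP; exists (\row_r inside (enum_val r)); apply/rowP => i.
rewrite mul_face_incidence => [|d]; last by rewrite /inside W_face //; apply: (valP d).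
rewrite /inside -F2_natr_addb W_boundary; last exact: (valP (edge_dart i)).
by rewrite edge_support_enum_val -F2_natr.
Qed.

Lemma euler_inequality : separating s -> (0 < #|G|)%N ->
  (#|oriented G| < #|G| + fcard (face_next s) {: dart G})%N.
Proof.
move=> sep G_gt0.
have faceE : #|faces| = fcard (face_next s) {: dart G}.
  by apply: eq_card => d; rewrite !inE andbT.
have := leq_trans (mxrankS (kermx_incidence sep)) (rank_leq_row _).
by rewrite mxrank_ker faceE; have := rank_incidence G_gt0; lia.
Qed.

End EulerInequality.

(** * Parity of crossings for segments in the plane *)

Section Segments.
Variable R : realFieldType.
Local Open Scope ring_scope.
Implicit Types a b c d v t u w : (R * R)%type.

Definition slope a b : R := (b.2 - a.2) / (b.1 - a.1).
Definition line a b (x : R) : R := a.2 + slope a b * (x - a.1).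

Lemma slopeC a b : slope a b = slope b a.
Proof. by rewrite /slope -[b.2 - _]opprB -[b.1 - _]opprB invrN mulrNN. Qed.

Lemma lineC a b x : a.1 != b.1 -> line a b x = line b a x.
Proof.
move=> ab; rewrite /line [slope b a]slopeC /slope; field.
by rewrite subr_eq0 eq_sym.
Qed.

Lemma line_left a b : line a b a.1 = a.2.
Proof. by rewrite /line subrr mulr0 addr0. Qed.

Lemma line_right a b : a.1 != b.1 -> line a b b.1 = b.2.
Proof. by move=> ab; rewrite lineC // line_left. Qed.

Definition spans a b (x : R) := (a.1 <= x <= b.1) || (b.1 <= x <= a.1).
Definition ospans a b (x : R) := (a.1 < x < b.1) || (b.1 < x < a.1).

Lemma spansC a b x : spans a b x = spans b a x. Proof. exact: orbC. Qed.
Lemma ospansC a b x : ospans a b x = ospans b a x. Proof. exact: orbC. Qed.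

Lemma ospans_lt a b x : a.1 < b.1 -> ospans a b x = (a.1 < x < b.1).
Proof.
move=> ab; rewrite /ospans; case: (boolP (b.1 < x < a.1)); rewrite ?orbF //.
by move=> /andP[/lt_trans /[apply]] /(lt_trans ab); rewrite ltxx.
Qed.

Definition noncrossing a b c d := forall x, spans a b x -> spans c d x ->
  line a b x = line c d x -> (x = a.1 \/ x = b.1) /\ (x = c.1 \/ x = d.1).

Lemma noncrossing_revl a b c d :
  a.1 != b.1 -> noncrossing a b c d -> noncrossing b a c d.
Proof.
move=> ab nc x; rewrite spansC -lineC // => ab_x cd_x eq_x.
by have [[->|->] ?] := nc x ab_x cd_x eq_x; split; auto.
Qed.

Lemma noncrossingC a b c d : noncrossing a b c d -> noncrossing c d a b.
Proof. by move=> nc x cd_x ab_x /esym eq_x; have [] := nc x ab_x cd_x eq_x. Qed.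

Lemma noncrossing_revr a b c d :
  c.1 != d.1 -> noncrossing a b c d -> noncrossing a b d c.
Proof. by move=> cd /noncrossingC nc; apply/noncrossingC/noncrossing_revl. Qed.

(* Counterclockwise order, starting from the downward direction, of the
   directions of the segments [v, t] and [v, u] around [v]. *)
Definition angle_le v t u :=
  ((v.1 <= t.1) && (u.1 < v.1)) ||
  (((t.1 < v.1) == (u.1 < v.1)) && (slope v t <= slope v u)).

Lemma angle_lexx v t : angle_le v t t.
Proof. by rewrite /angle_le eqxx lexx orbT. Qed.

Lemma angle_le_total v : total (angle_le v).
Proof.
move=> t u; rewrite /angle_le ![_ <= _.1]leNgt.
by case: (t.1 < v.1); case: (u.1 < v.1); rewrite //= ?le_total.
Qed.

Lemma angle_le_trans v : transitive (angle_le v).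
Proof.
move=> u t w; rewrite /angle_le ![_ <= _.1]leNgt.
by case: (t.1 < v.1); case: (u.1 < v.1); case: (w.1 < v.1) => //=; apply: le_trans.
Qed.

Lemma noncrossing_slope_neq v t u : v.1 != t.1 -> v.1 != u.1 ->
  noncrossing v t v u -> (t.1 < v.1) = (u.1 < v.1) -> slope v t != slope v u.
Proof.
wlog tu : t u / t.1 <= u.1 => [wlog_le vt vu nc side|vt vu nc side].
  have [/wlog_le|/ltW/wlog_le ut] := leP t.1 u.1; first exact.
  by rewrite eq_sym; apply: ut => //; apply: noncrossingC.
apply/eqP => slopeE.
have meet x : spans v t x -> spans v u x ->
    (x = v.1 \/ x = t.1) /\ (x = v.1 \/ x = u.1).
  by move=> vt_x vu_x; apply: nc; rewrite // /line slopeE.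
have [tv|vt_lt|tv] := ltgtP t.1 v.1; last by rewrite tv eqxx in vt.
  have uv : u.1 < v.1 by rewrite -side.
  have [||_ [] ?] := meet ((v.1 + u.1) / 2); rewrite /spans; lra.
have [||[] ? _] := meet ((v.1 + t.1) / 2); rewrite /spans; lra.
Qed.

Lemma angle_le_anti v t u : v.1 != t.1 -> v.1 != u.1 -> noncrossing v t v u ->
  ~~ (angle_le v t u && angle_le v u t).
Proof.
move=> vt vu nc; have := noncrossing_slope_neq vt vu nc.
rewrite /angle_le ![_ <= _.1]leNgt eq_le.
by case: (t.1 < v.1); case: (u.1 < v.1) => //= /(_ erefl).
Qed.

(* The contribution of the segment [c, d] to the parity of the region on the
   left of the segment from [a] to [b], seen from [a]: crossings of the upward
   vertical ray from [a], then a turn around [a]. *)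
Definition ray_parity c d a := (ospans c d a.1 && (a.2 < line c d a.1)) (+)
  (((c == a) && (c.1 < d.1)) (+) ((d == a) && (d.1 < c.1))).
Definition turn_parity c d a b :=
  ((c == a) && angle_le a d b) (+) ((d == a) && angle_le a c b).
Definition side_parity c d a b := ray_parity c d a (+) turn_parity c d a b.

Definition above a b v := ospans a b v.1 && (line a b v.1 < v.2).

Lemma side_parityC c d a b : c.1 != d.1 -> side_parity c d a b = side_parity d c a b.
Proof.
move=> cd; rewrite /side_parity /ray_parity /turn_parity ospansC lineC //.
by congr (_ (+) _ (+) _); apply: addbC.
Qed.

Lemma aboveC a b v : a.1 != b.1 -> above a b v = above b a v.
Proof. by move=> ab; rewrite /above ospansC lineC. Qed.

Lemma side_parity_right a b c d : a.1 < b.1 -> c.1 < d.1 ->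
  side_parity c d a b = ((c.1 < a.1 < d.1) && (a.2 < line c d a.1)) (+)
                        ((c == a) && (slope a b < slope c d)).
Proof.
move=> ab cd; rewrite /side_parity /ray_parity /turn_parity ospans_lt // cd (lt_gtF cd).
rewrite andbT andbF addbF -addbA; congr (_ (+) _).
have -> : (d == a) && angle_le a c b = false.
  apply/negP => /andP[/eqP da]; rewrite -da in ab *.
  by rewrite /angle_le leNgt cd (lt_gtF ab).
rewrite addbF; case: eqP => //= ca; rewrite -ca in ab *.
by rewrite /angle_le (lt_gtF ab) (lt_gtF cd) ltNge andbF.
Qed.

Lemma side_parity_left a b c d : a.1 < b.1 -> c.1 < d.1 ->
  side_parity c d b a = ((c.1 < b.1 < d.1) && (b.2 < line c d b.1)) (+)
                        ((d == b) && (slope c d <= slope a b)).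
Proof.
move=> ab cd; rewrite /side_parity /ray_parity /turn_parity ospans_lt // cd (lt_gtF cd).
rewrite andbT andbF addbF -addbA; congr (_ (+) _).
have -> : (c == b) && angle_le b d a = (c == b).
  by case: eqP => //= cb; rewrite -cb in ab *; rewrite /angle_le ab (ltW cd).
rewrite addbA addbb addFb; case: eqP => //= db; rewrite -db in ab *.
by rewrite /angle_le ab cd /= [slope d c]slopeC [slope d a]slopeC leNgt cd.
Qed.

Lemma side_parity_self a b : a.1 != b.1 -> side_parity a b a b (+) side_parity a b b a.
Proof.
wlog ab : a b / a.1 < b.1 => [wlog_lt|_].
  move=> ab; have [/wlog_lt/(_ ab)//|ba|eq_ab] := ltgtP a.1 b.1;
    last by rewrite eq_ab eqxx in ab.
  rewrite addbC [side_parity a b b a]side_parityC // [side_parity a b a b]side_parityC //.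
  by rewrite wlog_lt // eq_sym.
by rewrite side_parity_right // side_parity_left // !ltxx !eqxx ab lexx.
Qed.

Lemma affine_sign (f : R -> R) (k lo hi : R) :
  (forall x y, f x = f y + k * (x - y)) -> lo <= hi ->
  (forall x, lo <= x <= hi -> f x != 0) -> (0 < f lo) = (0 < f hi).
Proof.
move=> f_affine lohi f_neq0.
have pos_propagates (g : R -> R) (l : R) : (forall x y, g x = g y + l * (x - y)) ->
    (forall x, lo <= x <= hi -> g x != 0) -> 0 < g lo -> 0 < g hi.
  move=> g_affine g_neq0 g_lo; rewrite ltNge; apply/negP => g_hi.
  pose ratio := g lo / (g lo - g hi).
  have ratio_ge0 : 0 <= ratio by apply: divr_ge0; lra.
  have ratio_le1 : ratio <= 1 by rewrite ler_pdivrMr ?mul1r; lra.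
  have ratio_in : lo <= lo + (hi - lo) * ratio <= hi by apply/andP; split; nra.
  have /eqP[] := g_neq0 _ ratio_in.
  rewrite (g_affine _ lo) [lo + _]addrC addrK mulrA.
  have -> : l * (hi - lo) = g hi - g lo by rewrite (g_affine hi lo); ring.
  by rewrite /ratio; field; lra.
have f_lo : f lo != 0 by apply: f_neq0; rewrite lexx lohi.
have f_hi : f hi != 0 by apply: f_neq0; rewrite lexx lohi.
apply/idP/idP => [|fhi_gt0]; first exact: pos_propagates f_affine f_neq0.
rewrite lt_neqAle eq_sym f_lo leNgt; apply: contraTN fhi_gt0 => f_lo_lt0.
rewrite -leNgt -oppr_ge0 ltW // (pos_propagates (fun x => - f x) (- k)) ?oppr_gt0 //.
  by move=> x y; rewrite (f_affine x y); ring.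
by move=> x /f_neq0; rewrite oppr_eq0.
Qed.

Lemma side_parity_disjoint a b c d : a.1 < b.1 -> c.1 < d.1 ->
  d.1 <= a.1 \/ b.1 <= c.1 ->
  side_parity c d a b (+) side_parity c d b a = above a b c (+) above a b d.
Proof.
move=> ab cd disj.
rewrite side_parity_right // side_parity_left // /above !ospans_lt //.
have neq_ca : c.1 != a.1.
  by rewrite neq_lt; apply/orP; case: disj => ?; [left|right]; lra.
have -> : (c == a) = false by apply: contraNF neq_ca => /eqP->.
have neq_db : d.1 != b.1.
  by rewrite neq_lt; apply/orP; case: disj => ?; [left|right]; lra.
have -> : (d == b) = false by apply: contraNF neq_db => /eqP->.
have disjoint x y : (c.1 < x < d.1) && (a.1 <= x <= b.1) = false /\
    (a.1 < y < b.1) && (c.1 <= y <= d.1) = false.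
  by case: disj => ?; split; apply/negP; lra.
have := disjoint a.1 c.1; have := disjoint b.1 d.1.
by rewrite !lexx !(ltW ab) !(ltW cd) !andbT => -[-> ->] [-> ->].
Qed.

Section RightwardPair.
Variables a b c d : R * R.
Hypotheses (ab : a.1 < b.1) (cd : c.1 < d.1) (nc : noncrossing a b c d).

Let gap x := line c d x - line a b x.

Lemma gap_affine x y : gap x = gap y + (slope c d - slope a b) * (x - y).
Proof. by rewrite /gap /line; ring. Qed.

Lemma gap_neq0 x : a.1 <= x <= b.1 -> c.1 <= x <= d.1 ->
  ~ ((x = a.1 \/ x = b.1) /\ (x = c.1 \/ x = d.1)) -> gap x != 0.
Proof.
move=> ab_x cd_x not_ends; apply/negP; rewrite subr_eq0 => /eqP/esym meet.
by apply/not_ends/nc => //; rewrite /spans ?ab_x ?cd_x.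
Qed.

(* Each end of the common abscissa range sees the constant sign of the gap. *)
Lemma side_parity_right_gap m : (a.1 = c.1 -> a = c) ->
  a.1 < m < b.1 -> c.1 < m < d.1 ->
  side_parity c d a b (+) above a b c = (0 < gap m).
Proof.
move=> ac ab_m cd_m; rewrite side_parity_right // /above ospans_lt //.
have cb : c.1 < b.1 by lra.
have ad : a.1 < d.1 by lra.
rewrite ad cb !andbT.
have [ca|ac_lt|eq_ca] := ltgtP c.1 a.1.
- have /negPf-> : c != a by apply: contraTneq ca => ->; rewrite ltxx.
  rewrite /= !addbF -[a.2](line_left a b) -subr_gt0.
  by apply: (affine_sign gap_affine) => [|x xm]; [lra | apply: gap_neq0; lra].
- have /negPf-> : c != a by apply: contraTneq ac_lt => ->; rewrite ltxx.
  rewrite /= -[X in _ < X](line_left c d) -subr_gt0.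
  by apply: (affine_sign gap_affine) => [|x xm]; [lra | apply: gap_neq0; lra].
have {}ac := ac (esym eq_ca); rewrite -ac eqxx /= addbF.
have gap_a : gap a.1 = 0 by rewrite /gap -ac !line_left subrr.
rewrite (gap_affine m a.1) gap_a add0r -ac.
by rewrite pmulr_lgt0 subr_gt0 //; lra.
Qed.

Lemma side_parity_left_gap m : (b.1 = d.1 -> b = d) ->
  a.1 < m < b.1 -> c.1 < m < d.1 ->
  side_parity c d b a (+) above a b d = (0 < gap m).
Proof.
move=> bd ab_m cd_m; rewrite side_parity_left // /above ospans_lt //.
have cb : c.1 < b.1 by lra.
have ad : a.1 < d.1 by lra.
rewrite ad cb /=.
have [db|bd_lt|eq_db] := ltgtP d.1 b.1.
- have /negPf-> : d != b by apply: contraTneq db => ->; rewrite ltxx.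
  rewrite /= -[X in _ < X](@line_right c d) ?lt_eqF // -subr_gt0.
  by apply/esym/(affine_sign gap_affine) => [|x xm]; [lra | apply: gap_neq0; lra].
- have /negPf-> : d != b by apply: contraTneq bd_lt => ->; rewrite ltxx.
  rewrite /= !addbF -[X in X < _](@line_right a b) ?lt_eqF // -subr_gt0.
  by apply/esym/(affine_sign gap_affine) => [|x xm]; [lra | apply: gap_neq0; lra].
have {}bd := bd (esym eq_db); rewrite -bd eqxx /= addbF.
have gap_b : gap b.1 = 0.
  by rewrite /gap line_right ?lt_eqF // bd line_right ?lt_eqF // subrr.
have gap_m : gap m = (slope a b - slope c d) * (b.1 - m).
  by rewrite (gap_affine m b.1) gap_b; ring.
have : gap m != 0 by apply: gap_neq0; lra.
have b_m : 0 < b.1 - m by lra.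
rewrite gap_m pmulr_lgt0 // subr_gt0 bd.
by rewrite mulf_eq0 negb_or subr_eq0 le_eqVlt [_ == slope a d]eq_sym => /andP[/negPf->].
Qed.

End RightwardPair.

Lemma side_parity_noncrossing a b c d : a.1 != b.1 -> c.1 != d.1 ->
  (a.1 = c.1 -> a = c) -> (a.1 = d.1 -> a = d) ->
  (b.1 = c.1 -> b = c) -> (b.1 = d.1 -> b = d) ->
  noncrossing a b c d ->
  side_parity c d a b (+) side_parity c d b a = above a b c (+) above a b d.
Proof.
wlog ab : a b / a.1 < b.1 => [wlog_ab|_].
  move=> ab cd ac ad bc bd nc.
  have [/wlog_ab|ba|eq_ab] := ltgtP a.1 b.1; [exact| |by rewrite eq_ab eqxx in ab].
  rewrite addbC (aboveC c ab) (aboveC d ab).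
  by apply: wlog_ab => //; [rewrite eq_sym | apply: noncrossing_revl].
wlog cd : c d / c.1 < d.1 => [wlog_cd|_].
  move=> cd ac ad bc bd nc.
  have [/wlog_cd|dc|eq_cd] := ltgtP c.1 d.1; [exact| |by rewrite eq_cd eqxx in cd].
  rewrite [RHS]addbC !(side_parityC _ _ cd).
  by apply: wlog_cd => //; [rewrite eq_sym | apply: noncrossing_revr].
move=> ac _ _ bd nc.
have [da|ad] := leP d.1 a.1; first by apply: side_parity_disjoint => //; left.
have [bc|cb] := leP b.1 c.1; first by apply: side_parity_disjoint => //; right.
have [m [ab_m cd_m]] : exists m, a.1 < m < b.1 /\ c.1 < m < d.1.
  exists ((Num.max a.1 c.1 + Num.min b.1 d.1) / 2).
  by rewrite maxEle minEle; case: ifP; case: ifP; lra.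
have := side_parity_right_gap ab cd nc ac ab_m cd_m.
rewrite -(side_parity_left_gap ab cd nc bd ab_m cd_m).
by do 2![case: (side_parity _ _ _ _)]; do 2![case: (above _ _ _)].
Qed.

End Segments.

(** * The rotation system of a polygonal drawing *)

Lemma big_addb_telescope (f : nat -> bool) m :
  \big[addb/false]_(0 <= i < m) (f i (+) f i.+1) = f 0 (+) f m.
Proof.
rewrite (telescope_big (fun i j => f i (+) f j)) => [|i _];
  last by rewrite /= -addbA addKb.
by case: m => //=; rewrite addbb.
Qed.

Lemma index_prev (T : eqType) (s : seq T) (x : T) : uniq s -> x \in s ->
  index (prev s x) s = if index x s is i.+1 then i else (size s).-1.
Proof.
move=> s_uniq xs; rewrite prev_nth xs; case: s s_uniq xs => // h s hs_uniq xs.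
have [<-|hx] := eqVneq h x.
  have -> : index h (h :: s) = 0 by rewrite /= eqxx.
  have -> : index h s = size s by apply: memNindex; case/andP: hs_uniq.
  by rewrite index_uniq.
have -> : index x (h :: s) = (index x s).+1 by rewrite /= (negPf hx).
by rewrite index_uniq // /= ltnS index_size.
Qed.

Lemma big_addb_prefix_prev (T : eqType) (s : seq T) (F : pred T) x :
  uniq s -> x \in s -> \big[addb/false]_(y <- s) F y = false ->
  \big[addb/false]_(y <- s | index y s <= index (prev s x) s) F y =
  \big[addb/false]_(y <- s | index y s <= index x s) F y (+) F x.
Proof.
move=> s_uniq xs total; rewrite index_prev //.
have index_eq y : y \in s -> (index y s == index x s) = (y == x).
  by move=> ys; apply/eqP/eqP => [/(congr1 (nth x s))|->//]; rewrite !nth_index.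
have -> : \big[addb/false]_(y <- s | index y s <= index x s) F y =
    \big[addb/false]_(y <- s | index y s < index x s) F y (+) F x.
  rewrite [LHS]big_mkcond (bigD1_seq x) //= leqnn addbC -big_mkcondr; congr (_ (+) _).
  rewrite big_seq_cond [RHS]big_seq_cond; apply: eq_bigl => y.
  by case: (boolP (y \in s)) => //= ys; rewrite ltn_neqAle index_eq.
rewrite -addbA addbb addbF; case: (index x s) => [|//].
rewrite [RHS]big_pred0 // -[RHS]total big_seq_cond [RHS]big_seq_cond.
apply: eq_bigl => y; case: (boolP (y \in s)) => //= ys.
by rewrite -ltnS prednK ?index_mem // (leq_ltn_trans _ (_ : index y s < _)) ?index_mem.
Qed.

Lemma big_addb_nbrs (G : sgraph) (s : rotation_system G) (Z : rel G) (P : pred G) x :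
  subrel Z adj ->
  \big[addb/false]_y (Z x y && P y) = \big[addb/false]_(y <- s x | P y) Z x y.
Proof.
move=> Z_adj; rewrite [RHS]big_mkcond [RHS]big_uniq ?cyclic_nbrs_uniq //.
rewrite [LHS](bigID (mem (s x))) /= [X in _ (+) X]big1 ?addbF.
  by apply: eq_bigr => y _; rewrite andbC; case: (P y).
by move=> y; rewrite mem_cyclic_nbrs => nxy; rewrite (contraNF (@Z_adj x y)).
Qed.

(* Edge [e] is drawn as the polygonal line [joint e 0, ..., joint e (bends e).+1]. *)
Record polydrawing (R : realFieldType) (G : sgraph) (pos : G -> R * R)
    (bends : G * G -> nat) (joint : G * G -> nat -> R * R) : Prop := PolyDrawing {
  pd_inj : injective pos;
  pd_first : forall e, oriented G e -> joint e 0 = pos e.1;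
  pd_last : forall e, oriented G e -> joint e (bends e).+1 = pos e.2;
  pd_bend : forall e i z, oriented G e -> 0 < i <= bends e -> joint e i <> pos z;
  pd_simple : forall e i j, oriented G e -> i <= (bends e).+1 -> j <= (bends e).+1 ->
    joint e i = joint e j -> i = j;
  pd_disjoint : forall e i e' i', oriented G e -> oriented G e' ->
    0 < i <= bends e -> i' <= (bends e').+1 -> joint e i = joint e' i' -> e = e' }.

Record generic_polydrawing (R : realFieldType) (G : sgraph) (pos : G -> R * R)
    (bends : G * G -> nat) (joint : G * G -> nat -> R * R) : Prop :=
    GenericPolyDrawing {
  gpd_polydrawing :> polydrawing pos bends joint;
  gpd_abscissa : forall e i e' i', oriented G e -> oriented G e' ->
    i <= (bends e).+1 -> i' <= (bends e').+1 ->
    (joint e i).1 = (joint e' i').1 -> joint e i = joint e' i';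
  gpd_noncrossing : forall e i e' i', oriented G e -> oriented G e' ->
    i <= bends e -> i' <= bends e' -> (e, i) <> (e', i') ->
    noncrossing (joint e i) (joint e i.+1) (joint e' i') (joint e' i'.+1) }.

Section Drawing.
Variables (R : realFieldType) (G : sgraph) (pos : G -> R * R).
Variables (bends : G * G -> nat) (joint : G * G -> nat -> R * R).
Hypothesis drawn : generic_polydrawing pos bends joint.

Lemma joint_abscissa_neq e i : oriented G e -> i <= bends e ->
  (joint e i).1 != (joint e i.+1).1.
Proof.
move=> oe ie; have ie1 : i.+1 <= (bends e).+1 by [].
apply/eqP => /(gpd_abscissa drawn oe oe (leqW ie) ie1).
by move/(pd_simple drawn oe (leqW ie) ie1)/n_Sn.
Qed.

Lemma joint_eq_bend e i e' i' : oriented G e -> 0 < i <= bends e ->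
  oriented G e' -> i' <= (bends e').+1 ->
  (joint e' i' == joint e i) = ((e', i') == (e, i)).
Proof.
move=> oe ie oe' ie'; apply/eqP/eqP => [joints|[-> ->//]].
have ee' : e = e' by apply: (pd_disjoint drawn oe oe' ie ie'); rewrite joints.
rewrite -{}ee' in ie' joints *; congr (_, _).
by apply: (pd_simple drawn oe ie' _ joints); lia.
Qed.

Lemma joint_eq_pos e i z : oriented G e -> i <= (bends e).+1 ->
  (joint e i == pos z) =
  ((i == 0) && (e.1 == z)) || ((i == (bends e).+1) && (e.2 == z)).
Proof.
move=> oe ie; case: (posnP i) => [->|i_gt0].
  by rewrite (pd_first drawn oe) (inj_eq (pd_inj drawn)) /= orbF.
have [i_bend|i_last] := leqP i (bends e); last first.
  have -> : i = (bends e).+1 by lia.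
  by rewrite (pd_last drawn oe) (inj_eq (pd_inj drawn)) eqxx.
have -> : (i == (bends e).+1) = false by lia.
by apply/eqP; apply: (pd_bend drawn oe); rewrite i_gt0.
Qed.

Lemma joint_noncrossing_side e i e' i' : oriented G e -> oriented G e' ->
  i <= bends e -> i' <= bends e' -> (e', i') != (e, i) ->
  let a := joint e i in let b := joint e i.+1 in
  let c := joint e' i' in let d := joint e' i'.+1 in
  side_parity c d a b (+) side_parity c d b a = above a b c (+) above a b d.
Proof.
move=> oe oe' ie ie' neq; apply: side_parity_noncrossing; try exact: joint_abscissa_neq.
1-4: by apply: (gpd_abscissa drawn) => //; rewrite ?leqW.
by apply: (gpd_noncrossing drawn) => //; apply/eqP; rewrite eq_sym.
Qed.

Definition first_joint (x y : G) :=
  if enum_rank x < enum_rank y then joint (x, y) 1 else joint (y, x) (bends (y, x)).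

Section Parity.
Variable Z : rel G.
Hypothesis Z_even : even_edge_set Z.

Let Z_sym : symmetric Z. Proof. by case: Z_even. Qed.
Let Z_adj : subrel Z adj. Proof. by case: Z_even. Qed.

Definition segment_parity (F : G * G -> nat -> bool) : bool :=
  \big[addb/false]_(e | oriented G e)
    (Z e.1 e.2 && \big[addb/false]_(0 <= i < (bends e).+1) F e i).

Lemma segment_parityD F F' :
  segment_parity F (+) segment_parity F' = segment_parity (fun e i => F e i (+) F' e i).
Proof.
rewrite -big_split /=; apply: eq_bigr => e _; rewrite -andb_addr.
by rewrite -big_split.
Qed.

Lemma eq_segment_parity F F' :
  (forall e i, oriented G e -> i <= bends e -> F e i = F' e i) ->
  segment_parity F = segment_parity F'.
Proof.
move=> FF'; apply: eq_bigr => e oe; congr (_ && _).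
by apply: eq_big_nat => i ie; apply: FF'.
Qed.

Lemma segment_parity_delta e j (b : bool) : oriented G e -> j <= bends e ->
  segment_parity (fun e' i => ((e', i) == (e, j)) && b) = Z e.1 e.2 && b.
Proof.
move=> oe je; rewrite /segment_parity (bigD1 e) //= [X in _ (+) X]big1 ?addbF.
  under eq_bigr => i _ do rewrite xpair_eqE eqxx /=.
  have -> : \big[addb/false]_(0 <= i < (bends e).+1) ((i == j) && b) =
      \big[addb/false]_(0 <= i < (bends e).+1 | i == j) b.
    by rewrite [RHS]big_mkcond; apply: eq_bigr => i _; case: (i == j).
  by rewrite big_nat1_eq ltnS je.
move=> e' /andP[_ /negPf ne]; rewrite big1 ?andbF // => i _.
by rewrite xpair_eqE ne.
Qed.

Lemma segment_parity_boundary (P : R * R -> bool) :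
  segment_parity (fun e i => P (joint e i) (+) P (joint e i.+1)) = false.
Proof.
rewrite /segment_parity (eq_bigr (fun e =>
  (Z e.1 e.2 && P (pos e.1)) (+) (Z e.2 e.1 && P (pos e.2)))) => [|e oe]; last first.
  rewrite big_addb_telescope (pd_first drawn) // (pd_last drawn) //.
  by rewrite [Z e.2 _]Z_sym -andb_addr.
rewrite -(@big_oriented _ _ _ _ (fun x y => Z x y && P (pos x))) => [|x y nxy];
  last by rewrite (contraNF (@Z_adj x y)).
case: Z_even => _ _ even; rewrite big1 // => x _.
by rewrite -big_distrl /= -/(degree_parity Z x) even.
Qed.

(* The parity of the number of crossings of [Z] with the upward vertical ray
   starting just to the left of the segment from [a] to [b], near [a]. *)
Definition left_parity (a b : R * R) :=
  segment_parity (fun e i => side_parity (joint e i) (joint e i.+1) a b).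

Lemma left_parity_rev e j : oriented G e -> j <= bends e ->
  left_parity (joint e j) (joint e j.+1) (+) left_parity (joint e j.+1) (joint e j) =
  Z e.1 e.2.
Proof.
move=> oe je; rewrite segment_parityD; set a := joint e j; set b := joint e j.+1.
rewrite (@eq_segment_parity _ (fun e' i =>
    (above a b (joint e' i) (+) above a b (joint e' i.+1)) (+)
    (((e', i) == (e, j)) && true))) => [|e' i oe' ie'].
  by rewrite -segment_parityD segment_parity_boundary segment_parity_delta ?andbT.
have [[-> ->]|ne] := eqVneq (e', i) (e, j); last first.
  by rewrite addbF; apply: joint_noncrossing_side.
by rewrite side_parity_self ?joint_abscissa_neq // /above /ospans !ltxx !andbF.
Qed.

Lemma left_parity_turn a : exists k : bool, forall b, left_parity a b =
  k (+) segment_parity (fun e i => turn_parity (joint e i) (joint e i.+1) a b).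
Proof.
by exists (segment_parity (fun e i => ray_parity (joint e i) (joint e i.+1) a)) => b;
  rewrite segment_parityD.
Qed.

Lemma left_parity_bend e j : oriented G e -> j < bends e ->
  left_parity (joint e j.+1) (joint e j.+2) =
  left_parity (joint e j.+1) (joint e j) (+) Z e.1 e.2.
Proof.
move=> oe je; have [k turnE] := left_parity_turn (joint e j.+1).
rewrite !turnE -addbA; congr (_ (+) _); apply: (canRL (addKb _)).
rewrite segment_parityD.
set u := joint e j; set v := joint e j.+1; set w := joint e j.+2.
have uv : v.1 != u.1 by rewrite eq_sym; apply: joint_abscissa_neq (ltnW je).
have vw : v.1 != w.1 by apply: joint_abscissa_neq.
have nc : noncrossing v u v w.
  apply: noncrossing_revl; first by rewrite eq_sym.
  by apply: (gpd_noncrossing drawn) => //; [apply: ltnW | case=> /n_Sn].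
rewrite (@eq_segment_parity _ (fun e' i =>
    (((e', i) == (e, j)) && ~~ angle_le v u w) (+)
    (((e', i) == (e, j.+1)) && ~~ angle_le v w u))) => [|e' i oe' ie'].
  rewrite -segment_parityD !segment_parity_delta ?(ltnW je) //.
  have := angle_le_anti uv vw nc; have := angle_le_total v u w.
  by case: (angle_le v u w); case: (angle_le v w u); case: (Z _ _).
have j_bend : 0 < j.+1 <= bends e by [].
rewrite /turn_parity (joint_eq_bend oe j_bend oe' (leqW ie')).
rewrite (joint_eq_bend oe j_bend oe' (ie' : i.+1 <= (bends e').+1)).
have -> : ((e', i.+1) == (e, j.+1)) = ((e', i) == (e, j)) by rewrite !xpair_eqE eqSS.
have [[-> ->]|ne] := eqVneq (e', i) (e, j).
  have -> : ((e, j) == (e, j.+1)) = false by rewrite xpair_eqE andbC; lia.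
  by rewrite /= angle_lexx; case: angle_le.
case: eqP => [[-> ->]|_] //=.
by rewrite -/w angle_lexx; case: angle_le.
Qed.

Lemma left_parity_arc e : oriented G e ->
  left_parity (pos e.1) (joint e 1) (+) left_parity (pos e.2) (joint e (bends e)) =
  Z e.1 e.2.
Proof.
move=> oe; rewrite -(pd_first drawn oe) -(pd_last drawn oe).
suff -> : left_parity (joint e 0) (joint e 1) =
    left_parity (joint e (bends e)) (joint e (bends e).+1) by apply: left_parity_rev.
have: bends e <= bends e by []; move: {1 3 4}(bends e) => m.
elim: m => // m IH m_lt; rewrite IH ?(ltnW m_lt) // left_parity_bend //.
by rewrite -(left_parity_rev oe (ltnW m_lt)) addbC addbK.
Qed.

Lemma left_parity_dart x y : adj x y ->
  left_parity (pos x) (first_joint x y) (+) left_parity (pos y) (first_joint y x) =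
    Z x y.
Proof.
move=> axy; rewrite /first_joint; case: ltngtP => [lt|gt|/val_inj/enum_rank_inj xy].
- by apply: (left_parity_arc (e := (x, y))); rewrite /oriented /= axy lt.
- rewrite addbC Z_sym; apply: (left_parity_arc (e := (y, x))).
  by rewrite /oriented /= adj_sym axy gt.
- by rewrite xy adj_irrefl in axy.
Qed.

Lemma left_parity_vertex x : exists k : bool, forall b, left_parity (pos x) b =
  k (+) \big[addb/false]_z (Z x z && angle_le (pos x) (first_joint x z) b).
Proof.
have [k turnE] := left_parity_turn (pos x); exists k => b.
rewrite turnE; congr (_ (+) _).
rewrite (@big_oriented_at _ _ _ G x) => [|y nxy];
  last by rewrite (contraNF (@Z_adj x y)).
apply: eq_bigr => e oe; have /andP[/= _ lt] := oe.
rewrite /turn_parity big_split /= andb_addr; congr (_ (+) _).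
- rewrite big_nat_recl // big1_seq ?addbF => [|i]; last first.
    rewrite mem_index_iota => /andP[_ ie].
    by rewrite joint_eq_pos //=; last lia; rewrite eqSS [i == _]ltn_eqF.
  rewrite (pd_first drawn oe) (inj_eq (pd_inj drawn)).
  by case: eqP => [<-|_]; rewrite ?andbF //= /first_joint lt -surjective_pairing.
- rewrite big_nat_recr //= big1_seq ?addFb => [|i]; last first.
    rewrite mem_index_iota => /andP[_ ie].
    by rewrite joint_eq_pos //=; last lia; rewrite eqSS [i == _]ltn_eqF.
  rewrite (pd_last drawn oe) (inj_eq (pd_inj drawn)) [Z e.1 _]Z_sym.
  case: eqP => [<-|_]; rewrite ?andbF //=.
  by rewrite /first_joint ltnNge (ltnW lt) /= -surjective_pairing.
Qed.

End Parity.

Lemma first_joint_segment x y : adj x y -> exists e i, [/\ oriented G e, i <= bends e,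
  e = (x, y) \/ e = (y, x) &
  (joint e i = pos x /\ joint e i.+1 = first_joint x y) \/
  (joint e i.+1 = pos x /\ joint e i = first_joint x y)].
Proof.
move=> axy; rewrite /first_joint; case: ltngtP => [lt|gt|/val_inj/enum_rank_inj xy].
- have oe : oriented G (x, y) by rewrite /oriented /= axy.
  by exists (x, y), 0; split; auto; left; rewrite (pd_first drawn).
- have oe : oriented G (y, x) by rewrite /oriented /= adj_sym axy.
  by exists (y, x), (bends (y, x)); split; auto; right; rewrite (pd_last drawn).
- by rewrite xy adj_irrefl in axy.
Qed.

Lemma first_joint_abscissa_neq x y : adj x y -> (pos x).1 != (first_joint x y).1.
Proof.
move=> /first_joint_segment[e [i [oe ie _ ends]]].
by have := joint_abscissa_neq oe ie; case: ends => -[-> ->] //; rewrite eq_sym.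
Qed.

Lemma first_joint_noncrossing x y z : adj x y -> adj x z -> y != z ->
  noncrossing (pos x) (first_joint x y) (pos x) (first_joint x z).
Proof.
move=> axy axz yz.
have [e [i [oe ie eE ends]]] := first_joint_segment axy.
have [e' [i' [oe' ie' eE' ends']]] := first_joint_segment axz.
have ne : (e, i) <> (e', i').
  case=> ee' _; case/eqP: yz; move: eE eE' axz; rewrite -ee'.
  by case=> -> [] [] // => [-> _|_ ->]; rewrite adj_irrefl.
have := gpd_noncrossing drawn oe oe' ie ie' ne.
have := joint_abscissa_neq oe ie; have := joint_abscissa_neq oe' ie'.
case: ends => -[-> ->]; case: ends' => -[-> ->] //.
- by move=> neq' _; apply: noncrossing_revr.
- by move=> _ neq; apply: noncrossing_revl.
- by move=> neq' neq nc; apply: noncrossing_revr neq' (noncrossing_revl neq nc).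
Qed.

Definition nbr_order x : rel G := fun y z =>
  angle_le (pos x) (first_joint x y) (first_joint x z).

Definition sorted_nbrs x : seq G := sort (nbr_order x) (enum [pred y | adj x y]).

Lemma sorted_nbrs_uniq x : uniq (sorted_nbrs x).
Proof. by rewrite sort_uniq enum_uniq. Qed.

Lemma mem_sorted_nbrs x y : (y \in sorted_nbrs x) = adj x y.
Proof. by rewrite mem_sort mem_enum. Qed.

Definition drawing_rotation : rotation_system G :=
  RotationSystem sorted_nbrs_uniq mem_sorted_nbrs.

Lemma nbr_order_index x y z : adj x y -> adj x z ->
  nbr_order x y z = (index y (sorted_nbrs x) <= index z (sorted_nbrs x)).
Proof.
move=> axy axz; have [<-|yz] := eqVneq y z;
  first by rewrite leqnn /nbr_order angle_lexx.
have order_trans : transitive (nbr_order x) by move=> u v w; apply: angle_le_trans.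
have order_refl : reflexive (nbr_order x) by move=> u; apply: angle_lexx.
have order_sorted : sorted (nbr_order x) (sorted_nbrs x).
  by apply: sort_sorted => u v; apply: angle_le_total.
have index_le u v : adj x u -> adj x v ->
    index u (sorted_nbrs x) <= index v (sorted_nbrs x) -> nbr_order x u v.
  by move=> axu axv; apply: (sorted_leq_index order_trans order_refl order_sorted);
    rewrite mem_sorted_nbrs.
apply/idP/idP => [yz_le|]; last exact: index_le.
rewrite leqNgt; apply/negP => /ltnW/(index_le _ _ axz axy) zy_le.
have := angle_le_anti (first_joint_abscissa_neq axy) (first_joint_abscissa_neq axz)
  (first_joint_noncrossing axy axz yz).
by rewrite -/(nbr_order x y z) -/(nbr_order x z y) yz_le zy_le.
Qed.

Lemma drawing_rotation_separating : separating drawing_rotation.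
Proof.
move=> Z Z_even; exists (fun x y => left_parity Z (pos x) (first_joint x y)).
have left_dart := left_parity_dart Z_even; split=> x y axy; first exact: left_dart.
have [Z_sym Z_adj Z_parity] := Z_even; set s := drawing_rotation.
have ays : x \in s y by rewrite mem_cyclic_nbrs adj_sym.
have [k vertexE] := left_parity_vertex Z_even y.
have prefixE z : adj y z -> left_parity Z (pos y) (first_joint y z) =
    k (+) \big[addb/false]_(w <- s y | index w (s y) <= index z (s y)) Z y w.
  move=> ayz; rewrite vertexE (big_addb_nbrs s) //; congr (_ (+) _).
  rewrite big_seq_cond [RHS]big_seq_cond; apply: eq_bigl => w; rewrite mem_cyclic_nbrs.
  by case: (boolP (adj y w)) => //= ayw; rewrite -nbr_order_index.
rewrite prefixE -?(mem_cyclic_nbrs s) ?mem_prev //.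
rewrite big_addb_prefix_prev ?cyclic_nbrs_uniq //.
  rewrite addbA -prefixE -?(mem_cyclic_nbrs s) //.
  by rewrite Z_sym -(left_dart _ _ axy) addbC addbK.
rewrite -(big_addb_nbrs s xpredT) // -[RHS](Z_parity y).
by apply: eq_bigr => w _; rewrite andbT.
Qed.

End Drawing.

(** * The rotation system of a planar graph *)

Section Shear.
Variable R : realType.
Local Open Scope ring_scope.
Implicit Types a b c d z : plane R.

Definition shear (eps : R) a : plane R := (a.1 + eps * a.2, a.2).

Lemma shear_inj eps : injective (shear eps).
Proof. by move=> [a1 a2] [b1 b2] [/= + ab2]; rewrite ab2 => /addIr ->. Qed.

Lemma exists_injective_shear (s : seq (plane R)) :
  exists eps, {in s &, forall a b, (shear eps a).1 = (shear eps b).1 -> a = b}.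
Proof.
pose coincidence (ab : plane R * plane R) :=
  `|(ab.2.1 - ab.1.1) / (ab.1.2 - ab.2.2)|.
pose pairs := [seq (a, b) | a <- s, b <- s].
pose eps := 1 + \sum_(ab <- pairs) coincidence ab.
exists eps => a b sa sb /= sheared.
have [ab2|ab2] := eqVneq a.2 b.2.
  by move: a b sheared ab2 {sa sb} => [a1 a2] [b1 b2] /= + ab2; rewrite ab2 => /addIr->.
have pairs_ab : (a, b) \in pairs by apply: allpairs_f.
have eps_gt : coincidence (a, b) < eps.
  rewrite /eps (big_rem _ pairs_ab) /=.
  have : 0 <= \sum_(ab <- rem (a, b) pairs) coincidence ab.
    by apply: sumr_ge0 => ab _; apply: normr_ge0.
  lra.
have eps_coincidence : coincidence (a, b) = `|eps|.
  congr `|_|; apply: (mulIf (x := a.2 - b.2)); first by rewrite subr_eq0.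
  by rewrite mulfVK ?subr_eq0 //=; lra.
by exfalso; have := ler_norm eps; lra.
Qed.

Lemma segment_line a b x : a.1 != b.1 -> spans a b x -> segment a b (x, line a b x).
Proof.
move=> ab ab_x; exists ((x - a.1) / (b.1 - a.1)).
  move: ab ab_x; rewrite /spans; case: (ltgtP a.1 b.1) => // ab _ ab_x.
    by rewrite ler_pdivlMr ?ler_pdivrMr; lra.
  by rewrite ler_ndivlMr ?ler_ndivrMr; lra.
by rewrite /line /slope; congr (_, _); field; rewrite subr_eq0 eq_sym.
Qed.

Lemma segment_shear eps a b z :
  segment (shear eps a) (shear eps b) (shear eps z) -> segment a b z.
Proof.
case=> t t01 [/= zE1 zE2]; exists t => //; move: z zE1 zE2 => [z1 z2] /= zE1 zE2.
by congr (_, _) => //; rewrite zE2 in zE1; lra.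
Qed.

Lemma segment_left a b : segment a b a.
Proof.
by exists 0; rewrite ?lexx ?ler01 //; case: a => a1 a2 /=; congr (_, _); ring.
Qed.

Lemma segment_right a b : segment a b b.
Proof.
by exists 1; rewrite ?lexx ?ler01 //; case: b => b1 b2 /=; congr (_, _); ring.
Qed.

Definition meet_at_ends a b c d : Prop := forall z, segment a b z -> segment c d z ->
  (z = a \/ z = b) /\ (z = c \/ z = d).

Lemma shear_noncrossing eps a b c d :
  (shear eps a).1 != (shear eps b).1 -> (shear eps c).1 != (shear eps d).1 ->
  meet_at_ends a b c d ->
  noncrossing (shear eps a) (shear eps b) (shear eps c) (shear eps d).
Proof.
move=> ab cd ends x ab_x cd_x meet.
have := segment_line ab ab_x; have := segment_line cd cd_x; rewrite -{}meet.
set y := line _ _ x.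
have -> : (x, y) = shear eps (x - eps * y, y) by rewrite /shear /= subrK.
move=> /segment_shear cd_z /segment_shear ab_z.
have [z_ab z_cd] := ends _ ab_z cd_z.
have -> : x = (shear eps (x - eps * y, y)).1 by rewrite /= subrK.
by split; [case: z_ab => -> | case: z_cd => ->]; auto.
Qed.

End Shear.

Section Polyline.
Variable R : realType.
Local Open Scope classical_set_scope.

Definition simple_polyline (n : nat) (p : nat -> plane R) : Prop :=
  [/\ forall i, i <= n -> p i <> p i.+1,
      forall i, i < n ->
        segment (p i) (p i.+1) `&` segment (p i.+1) (p i.+2) = [set p i.+1] &
      forall i j, i.+1 < j <= n ->
        segment (p i) (p i.+1) `&` segment (p j) (p j.+1) = classical_sets.set0].

Definition polyline (n : nat) (p : nat -> plane R) : set (plane R) :=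
  \bigcup_(i in [set i | i <= n]) segment (p i) (p i.+1).

Lemma polygonal_arcP (P : set (plane R)) a b : polygonal_arc P a b <->
  exists n p, [/\ p 0 = a, p n.+1 = b, simple_polyline n p & P = polyline n p].
Proof.
by split=> -[n [p]] => [[[p0 pn] neq cons disj PE]|[p0 pn [neq cons disj] PE]];
  exists n, p; split.
Qed.

Variables (n : nat) (p : nat -> plane R).
Hypothesis p_simple : simple_polyline n p.

Lemma polyline_meet i j z : i < j <= n ->
  segment (p i) (p i.+1) z -> segment (p j) (p j.+1) z -> j = i.+1 /\ z = p j.
Proof.
move=> /andP[ij jn] seg_i seg_j; have [_ cons disj] := p_simple.
have [ji|ne] := eqVneq j i.+1.
  split=> //; rewrite ji in seg_j jn *.
  have : (segment (p i) (p i.+1) `&` segment (p i.+1) (p i.+2)) z by split.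
  by rewrite cons.
have far : i.+1 < j <= n by lia.
have : (segment (p i) (p i.+1) `&` segment (p j) (p j.+1)) z by [].
by rewrite disj.
Qed.

Lemma polyline_inj i j : i <= n.+1 -> j <= n.+1 -> p i = p j -> i = j.
Proof.
have [neq _ _] := p_simple; wlog ij : i j / i < j => [wlog_lt|] i_le j_le pij.
  by case: (ltngtP i j) => // lt; [apply: wlog_lt | apply/esym/wlog_lt].
case: j => // j in ij j_le pij *; exfalso.
have [eq_ij|ne] := eqVneq i j; first by rewrite eq_ij in pij; apply: neq pij.
have ij' : i < j <= n by lia.
have [|jE pE] := polyline_meet (z := p i) ij' (segment_left _ _).
  by rewrite pij; apply: segment_right.
by apply: (neq i); [lia | rewrite {1}pE jE].
Qed.

Lemma polyline_first i : i <= n -> segment (p i) (p i.+1) (p 0) -> i = 0.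
Proof.
move=> i_le seg_i; case: (posnP i) => // i_gt0.
have [|iE pE] := polyline_meet (i := 0) (j := i) _ (segment_left _ _) seg_i; first lia.
by have := polyline_inj (i := 0) (j := i) _ _ pE; lia.
Qed.

Lemma polyline_last i : i <= n -> segment (p i) (p i.+1) (p n.+1) -> i = n.
Proof.
move=> i_le seg_i; have [//|ne] := eqVneq i n.
have [|iE pE] := polyline_meet (i := i) (j := n) _ seg_i (segment_right _ _); first lia.
by have := polyline_inj (i := n.+1) (j := n) _ _ pE; lia.
Qed.

Lemma polyline_segments_meet i j : i <= n -> j <= n -> i != j ->
  meet_at_ends (p i) (p i.+1) (p j) (p j.+1).
Proof.
move=> i_le j_le; rewrite neq_ltn => /orP[] lt z seg_i seg_j.
  by have [|-> ->] := polyline_meet _ seg_i seg_j; [lia | auto].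
by have [|-> ->] := polyline_meet _ seg_j seg_i; [lia | auto].
Qed.

Lemma polyline_point i : i <= n.+1 -> polyline n p (p i).
Proof.
case: i => [|i] i_le; first by exists 0 => //; apply: segment_left.
by exists i => //; apply: segment_right.
Qed.

End Polyline.

Lemma oriented_set_inj (G : sgraph) (e e' : G * G) : oriented G e -> oriented G e' ->
  [set e.1; e.2] = [set e'.1; e'.2] -> e = e'.
Proof.
move=> /andP[_ lt] /andP[_ lt'] sets.
have mem1 : e.1 \in [set e'.1; e'.2] by rewrite -sets !inE eqxx.
have mem2 : e.2 \in [set e'.1; e'.2] by rewrite -sets !inE eqxx orbT.
case: e e' {sets} => [x y] [x' y'] /= in lt lt' mem1 mem2 *.
move: mem1 mem2 lt lt'; rewrite !inE => /orP[] /eqP-> /orP[] /eqP-> //;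
  rewrite ?ltnn //.
by move=> /ltn_trans trans /trans; rewrite ltnn.
Qed.

Section PlaneDrawing.
Variables (R : realType) (G : sgraph) (pos : G -> plane R)
  (arc : {set G} -> set (plane R)).
Hypothesis drawn : plane_drawing pos arc.
Variables (bends : G * G -> nat) (joint : G * G -> nat -> plane R).
Hypothesis arcs : forall e, oriented G e ->
  [/\ joint e 0 = pos e.1, joint e (bends e).+1 = pos e.2,
      simple_polyline (bends e) (joint e) &
      arc [set e.1; e.2] = polyline (bends e) (joint e)].

Let joint_inj e : oriented G e -> forall i j, i <= (bends e).+1 -> j <= (bends e).+1 ->
  joint e i = joint e j -> i = j.
Proof. by move=> /arcs[_ _ simple _] i j; apply: polyline_inj. Qed.

Let joint_arc e i : oriented G e -> i <= (bends e).+1 -> arc [set e.1; e.2] (joint e i).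
Proof. by move=> /arcs[_ _ _ ->]; apply: polyline_point. Qed.

Lemma bend_interior e i : oriented G e -> 0 < i <= bends e ->
  (arc [set e.1; e.2]%SET `\` [set pos e.1; pos e.2])%classic (joint e i).
Proof.
move=> oe ie; split; first by apply: joint_arc => //; lia.
have [<- <- _ _] := arcs oe.
by case=> /(joint_inj oe); lia.
Qed.

Lemma arcs_meet_at_vertices e e' z : oriented G e -> oriented G e' -> e <> e' ->
  arc [set e.1; e.2] z -> arc [set e'.1; e'.2] z -> [set pos e.1; pos e.2]%classic z.
Proof.
move=> oe oe' ne arc_e arc_e'; apply: contrapT => not_end.
have /andP[ae _] := oe; have /andP[ae' _] := oe'; have [_ _ _ cross] := drawn.
have := cross _ _ _ _ ae ae' (contra_not (oriented_set_inj oe oe') ne).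
by rewrite -classical_sets.subset0 => /(_ z); apply.
Qed.

Lemma segment_vertex_end e i z : oriented G e -> i <= bends e ->
  segment (joint e i) (joint e i.+1) z -> [set pos e.1; pos e.2]%classic z ->
  z = joint e i \/ z = joint e i.+1.
Proof.
move=> oe ie seg; have [<- <- simple _] := arcs oe.
case=> zE; rewrite /= zE in seg *.
  by left; rewrite (polyline_first simple ie seg).
by right; rewrite (polyline_last simple ie seg).
Qed.

Lemma segments_meet_at_joints e i e' i' : oriented G e -> oriented G e' ->
  i <= bends e -> i' <= bends e' -> (e, i) <> (e', i') ->
  meet_at_ends (joint e i) (joint e i.+1) (joint e' i') (joint e' i'.+1).
Proof.
move=> oe oe' ie ie' ne; have [ee'|ne_e] := eqVneq e e'.
  rewrite -{}ee' in ie' ne *; have [_ _ simple _] := arcs oe.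
  by apply: (polyline_segments_meet simple) => //; apply: contra_notN ne => /eqP->.
move=> z seg seg'.
have seg_arc f j : oriented G f -> j <= bends f ->
    segment (joint f j) (joint f j.+1) z -> arc [set f.1; f.2] z.
  by move=> /arcs[_ _ _ ->] jf; exists j.
have arc_z := seg_arc _ _ oe ie seg; have arc_z' := seg_arc _ _ oe' ie' seg'.
split; apply: segment_vertex_end => //;
  first exact: arcs_meet_at_vertices (elimN eqP ne_e) _ _.
by apply: arcs_meet_at_vertices arc_z' arc_z => //; apply/eqP; rewrite eq_sym.
Qed.

Lemma plane_drawing_polydrawing : polydrawing pos bends joint.
Proof.
have [pos_inj _ arc_vertex _] := drawn; split=> //.
- by move=> e /arcs[].
- by move=> e /arcs[].
- move=> e i z oe ie jointE; have /andP[ae _] := oe.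
  by apply: (arc_vertex _ _ z ae); rewrite -jointE; apply: bend_interior.
- by move=> e i j oe ie je; apply: joint_inj.
- move=> e i e' i' oe oe' ie ie' joints; apply: contrapT => ne.
  have [arc_e not_end] := bend_interior oe ie; apply: not_end.
  by apply: (arcs_meet_at_vertices oe oe' ne) => //; rewrite joints; apply: joint_arc.
Qed.

End PlaneDrawing.

Lemma shear_polydrawing (R : realType) (G : sgraph) (pos : G -> plane R)
  bends joint eps :
  polydrawing pos bends joint ->
  polydrawing (shear eps \o pos) bends (fun e i => shear eps (joint e i)).
Proof.
move=> drawn; split=> /=.
- exact/inj_comp/pd_inj/drawn/shear_inj.
- by move=> e /(pd_first drawn)->.
- by move=> e /(pd_last drawn)->.
- by move=> e i z oe ie /shear_inj; apply: pd_bend drawn _ _ _ oe ie.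
- by move=> e i j oe ie je /shear_inj; apply: pd_simple drawn _ _ _ oe ie je.
- by move=> e i e' i' oe oe' ie ie' /shear_inj;
    apply: pd_disjoint drawn _ _ _ _ oe oe' ie ie'.
Qed.

Lemma planar_generic_polydrawing (R : realType) (G : sgraph) : planar R G ->
  exists (pos : G -> plane R) bends joint, generic_polydrawing pos bends joint.
Proof.
case=> pos [arc drawn].
have ex_polyline (e : G * G) : exists p : nat * (nat -> plane R), oriented G e ->
    [/\ p.2 0 = pos e.1, p.2 p.1.+1 = pos e.2, simple_polyline p.1 p.2 &
        arc [set e.1; e.2] = polyline p.1 p.2].
  case: (boolP (oriented G e)) => [/andP[ae _]|_]; last by exists (0, fun=> pos e.1).
  have [_ arcP _ _] := drawn.
  by have /polygonal_arcP[n [p pP]] := arcP _ _ ae; exists (n, p).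
have {ex_polyline}[p arcs] := choice ex_polyline.
pose bends e := (p e).1; pose joint e := (p e).2.
pose joints := [seq joint e i | e <- enum {: G * G}, i <- iota 0 (bends e).+2].
have mem_joints e i : i <= (bends e).+1 -> joint e i \in joints.
  by move=> ie; apply: allpairs_f_dep; rewrite ?mem_enum // mem_iota.
have [eps eps_inj] := exists_injective_shear joints.
have poly : polydrawing pos bends joint := plane_drawing_polydrawing drawn arcs.
have abscissa_neq e i : oriented G e -> i <= bends e ->
    (shear eps (joint e i)).1 != (shear eps (joint e i.+1)).1.
  move=> oe ie; apply/eqP => /eps_inj joint_eq; have [_ _ [neq _ _] _] := arcs e oe.
  by apply: (neq _ ie); apply: joint_eq; apply: mem_joints => //; apply: leqW.
exists (shear eps \o pos), bends, (fun e i => shear eps (joint e i)).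
split=> [|e i e' i' oe oe' ie ie' /eps_inj joint_eq|e i e' i' oe oe' ie ie' ne].
- exact: shear_polydrawing.
- by rewrite joint_eq ?mem_joints.
- apply: shear_noncrossing; [exact: abscissa_neq | exact: abscissa_neq|].
  exact: (segments_meet_at_joints drawn arcs).
Qed.

Lemma planar_separating_rotation (R : realType) (G : sgraph) : planar R G ->
  exists s : rotation_system G, separating s.
Proof.
move=> /planar_generic_polydrawing[pos [bends [joint drawn]]].
by exists (drawing_rotation pos bends joint); apply: drawing_rotation_separating drawn.
Qed.

(** * Discharging *)

Section ShortCycles.
Variable G : sgraph.

Lemma cycle_has_subgraph (p : seq G) : uniq p -> cycle adj p ->
  has_subgraph G (cycle_graph (size p)).
Proof.
move=> p_uniq p_cycle; case: p => [|x0 p] in p_uniq p_cycle *.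
  by exists (fun i : 'I_0 => match (ltn_ord i : false) with end) => -[].
set q := x0 :: p in p_uniq p_cycle *.
exists (fun i : 'I_(size q) => nth x0 q i) => [i j /eqP|i j].
  by rewrite nth_uniq // => /eqP/val_inj.
have adj_next (i' j' : 'I_(size q)) : ordS i' == j' -> adj (nth x0 q i') (nth x0 q j').
  move=> /eqP<-; have := next_cycle p_cycle (mem_nth x0 (ltn_ord i')).
  rewrite next_nth mem_nth // index_uniq // /q /=.
  case: (ltnP i' (size p)) => i'p; first by rewrite modn_small.
  have -> : i' = size p :> nat by apply/eqP; rewrite eqn_leq i'p -ltnS (ltn_ord i').
  by rewrite modnn [nth x0 p _]nth_default.
case/andP=> _ /orP[]; first exact: adj_next.
by move/adj_next; rewrite adj_sym.
Qed.

Lemma adj_neq (x y : G) : adj x y -> x != y.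
Proof. by apply: contraTneq => ->; rewrite adj_irrefl. Qed.

Lemma triangle_has_subgraph (x y z : G) : adj x y -> adj y z -> adj z x ->
  has_subgraph G (cycle_graph 3).
Proof.
move=> xy yz zx; apply: (@cycle_has_subgraph [:: x; y; z]); last by rewrite /= xy yz zx.
by rewrite /= !inE negb_or (adj_neq xy) (adj_neq yz) eq_sym (adj_neq zx).
Qed.

Lemma square_has_subgraph (x y z w : G) : adj x y -> adj y z -> adj z w -> adj w x ->
  x != z -> y != w -> has_subgraph G (cycle_graph 4).
Proof.
move=> xy yz zw wx x_z y_w; apply: (@cycle_has_subgraph [:: x; y; z; w]).
  rewrite /= !inE !negb_or (adj_neq xy) (adj_neq yz) (adj_neq zw) x_z y_w.
  by rewrite eq_sym (adj_neq wx).
by rewrite /= xy yz zw wx.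
Qed.

End ShortCycles.

Lemma big_orbits (R : Type) (idx : R) (op : Monoid.com_law idx) (T : finType)
    (f : T -> T) (F : T -> R) : injective f ->
  \big[op/idx]_x F x =
  \big[op/idx]_(r | r \in froots f) \big[op/idx]_(x <- orbit f r) F x.
Proof.
move=> f_inj; have f_sym : connect_sym (frel f) by apply: fconnect_sym.
rewrite (partition_big (froot f) (fun r => r \in froots f)) /=; last first.
  by move=> x _; apply: roots_root.
apply: eq_bigr => r /eqP r_root; rewrite big_uniq ?orbit_uniq //.
apply: eq_bigl => x; rewrite -[in RHS]fconnect_orbit -[in LHS]r_root eq_sym.
by rewrite root_connect.
Qed.

Lemma big_darts_at (R : Type) (idx : R) (op : Monoid.com_law idx) (G : sgraph)
    (x : G) (F : G -> R) :
  \big[op/idx]_(d : dart G | (val d).1 == x) F (val d).2 =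
  \big[op/idx]_(y | adj x y) F y.
Proof.
transitivity (\big[op/idx]_(e : G * G | adj e.1 e.2 && (e.1 == x)) F e.2).
  apply/esym; exact: (big_sub_cond [pred e : G * G | adj e.1 e.2]
    (fun e => e.1 == x) (fun e : G * G => F e.2)).
rewrite (reindex_onto (fun y => (x, y)) snd) /=.
  by apply: eq_bigl => y; rewrite !eqxx !andbT.
by move=> [z y] /andP[_ /eqP/= ->].
Qed.

Lemma sumz_const (I : finType) (A : {pred I}) (c : int) :
  (\sum_(i in A) c = c * #|A|%:Z)%R.
Proof. by rewrite sumr_const -mulr_natr natz. Qed.

Section Discharging.
Variables (G : sgraph) (s : rotation_system G).
Hypotheses (no_C3 : ~ has_subgraph G (cycle_graph 3))
           (no_C4 : ~ has_subgraph G (cycle_graph 4))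
           (no_C6 : ~ has_subgraph G (cycle_graph 6)).
Hypothesis deg_ge2 : forall x : G, 2 <= deg x.

Definition high (x : G) := 42 <= deg x.
Definition high_degree (x : G) := #|[pred y | adj x y && high y]|.
Hypothesis low_high_degree : forall x : G, ~~ high x -> 0 < high_degree x.

Local Notation next := (face_next s).
Local Notation dart := (dart G).

Definition face_length (d : dart) := order next d.

Lemma face_length_next d : face_length (next d) = face_length d.
Proof. by apply/order_id_cycle/cycle_orbit/face_next_inj. Qed.

Lemma face_length_iter i d : face_length (iter i next d) = face_length d.
Proof. by elim: i => //= i; rewrite face_length_next. Qed.

Lemma size_cyclic_nbrs x : size (s x) = deg x.
Proof.
rewrite -(card_uniqP (cyclic_nbrs_uniq s x)).
by apply: eq_card => y; rewrite mem_cyclic_nbrs inE.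
Qed.

Lemma prev_neq x y : adj x y -> prev (s x) y != y.
Proof.
rewrite -(mem_cyclic_nbrs s) => xy; apply/eqP => prev_y.
have := index_prev (cyclic_nbrs_uniq s x) xy; rewrite prev_y.
have := deg_ge2 x; rewrite -size_cyclic_nbrs.
by case: (index y _) => [|i]; move: (size _) => m; lia.
Qed.

Lemma prev_swap_deg x y z : adj x y -> prev (s x) y = z -> prev (s x) z = y ->
  deg x = 2.
Proof.
rewrite -(mem_cyclic_nbrs s) => xy prev_y prev_z.
have xz : z \in s x by rewrite -prev_y mem_prev.
have := index_prev (cyclic_nbrs_uniq s x) xy.
have := index_prev (cyclic_nbrs_uniq s x) xz.
move: (deg_ge2 x) xy xz; rewrite prev_y prev_z -size_cyclic_nbrs -!index_mem.
by case: (index y _) => [|i]; case: (index z _) => [|j]; move: (size _) => m; lia.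
Qed.

Section FaceWalk.
Variable d : dart.

Definition face_vertex i := (val (iter i next d)).1.

Lemma face_vertex_adj i : adj (face_vertex i) (face_vertex i.+1).
Proof. exact: (valP (iter i next d)). Qed.

Lemma face_vertex_prev i :
  face_vertex i.+2 = prev (s (face_vertex i.+1)) (face_vertex i).
Proof. by []. Qed.

Lemma face_vertex_neq1 i : face_vertex i != face_vertex i.+1.
Proof. exact/adj_neq/face_vertex_adj. Qed.

Lemma face_vertex_neq2 i : face_vertex i != face_vertex i.+2.
Proof. by rewrite face_vertex_prev eq_sym prev_neq // adj_sym face_vertex_adj. Qed.

Lemma face_vertex_neq3 i : face_vertex i != face_vertex i.+3.
Proof.
apply/eqP => closed; apply: no_C3; apply: triangle_has_subgraph (face_vertex_adj i.+2).
  by rewrite -closed; apply: face_vertex_adj.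
exact: face_vertex_adj.
Qed.

Lemma face_vertex_period i : face_vertex (i + face_length d) = face_vertex i.
Proof. by rewrite /face_vertex iterD iter_order //; apply: face_next_inj. Qed.

Lemma pentagon_uniq : face_length d = 5 ->
  uniq [:: face_vertex 0; face_vertex 1; face_vertex 2; face_vertex 3; face_vertex 4].
Proof.
move=> pentagon; have period := face_vertex_period; rewrite pentagon in period.
have neq04 : face_vertex 0 != face_vertex 4.
  by rewrite eq_sym -(period 0) face_vertex_neq1.
have neq14 : face_vertex 1 != face_vertex 4.
  by rewrite eq_sym -(period 1) face_vertex_neq2.
rewrite /= !inE !negb_or !face_vertex_neq1 !face_vertex_neq2 face_vertex_neq3.
by rewrite neq04 neq14.
Qed.

Lemma face_lengthP : face_length d = 5 \/ 7 <= face_length d.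
Proof.
have length_gt0 : 0 < face_length d by apply: order_gt0.
have closed0 := face_vertex_period 0; have closed1 := face_vertex_period 1.
case: (ltnP 6 (face_length d)) => [|le6]; first by right.
left; case: (face_length d) length_gt0 le6 closed0 closed1.
  by [].
case=> [|[|[|[|[|[|//]]]]]] //= _ _ closed0 closed1; exfalso.
- by have := face_vertex_neq1 0; rewrite closed0 eqxx.
- by have := face_vertex_neq2 0; rewrite closed0 eqxx.
- by have := face_vertex_neq3 0; rewrite closed0 eqxx.
- apply/no_C4/(square_has_subgraph (face_vertex_adj 0) (face_vertex_adj 1)
    (face_vertex_adj 2)); rewrite ?face_vertex_neq2 //.
  by rewrite -closed0 face_vertex_adj.
- apply/no_C6/(@cycle_has_subgraph _ (map face_vertex (iota 0 6))).
    have neq04 : face_vertex 0 != face_vertex 4.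
      by rewrite -closed0 eq_sym face_vertex_neq2.
    have neq05 : face_vertex 0 != face_vertex 5.
      by rewrite -closed0 eq_sym face_vertex_neq1.
    have neq15 : face_vertex 1 != face_vertex 5.
      by rewrite -closed1 eq_sym face_vertex_neq2.
    rewrite /= !inE !negb_or !face_vertex_neq1 !face_vertex_neq2 !face_vertex_neq3.
    by rewrite neq04 neq05 neq15.
  by rewrite /= !face_vertex_adj -closed0 face_vertex_adj.
Qed.

End FaceWalk.

Lemma deg2_nbr (x a b y : G) : deg x = 2 -> adj x a -> adj x b -> a != b -> adj x y ->
  y = a \/ y = b.
Proof.
move=> deg2 xa xb ab xy; have [|ya] := eqVneq y a; [by left|right].
apply: contraTeq isT => yb; have : #|[set a; b; y]| <= deg x.
  by apply/subset_leq_card/subsetP => z; rewrite !inE => /orP[/orP[]|] /eqP->.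
by rewrite -setUA cardsU1 cards2 !inE negb_or ab eq_sym ya eq_sym yb deg2.
Qed.

Lemma glued_pentagons (x a b c e c' e' : G) :
  uniq [:: x; a; c; e; b] -> uniq [:: x; b; c'; e'; a] ->
  adj a c -> adj c e -> adj e b -> adj b c' -> adj c' e' -> adj e' a ->
  c = e' /\ e = c'.
Proof.
move=> + + a_c c_e e_b b_c' c'_e' e'_a.
rewrite /= !inE !negb_or => /and5P[_ /and3P[ac ae ab] /andP[ce cb] eb _].
move=> /and5P[_ /and3P[bc' be' _] /andP[c'e' c'a] e'a _].
have cc' : c != c'.
  by apply/eqP => cc'; apply/no_C3/(triangle_has_subgraph c_e e_b); rewrite cc'.
have ee' : e != e'.
  by apply/eqP => ee'; apply/no_C3/(triangle_has_subgraph a_c c_e); rewrite ee'.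
have [ce'|ce'] := eqVneq c e'; have [ec'|ec'] := eqVneq e c'; split=> //; exfalso.
- by apply/no_C4/(square_has_subgraph c_e e_b b_c'); rewrite ?ce' // -ce'.
- by apply/no_C4/(square_has_subgraph a_c c_e _ e'_a); rewrite // ec'.
all: apply/no_C6/(@cycle_has_subgraph _ [:: a; c; e; b; c'; e']);
  last by rewrite /= a_c c_e e_b b_c' c'_e' e'_a.
all: rewrite /= !inE !negb_or ac ae ab ce cb cc' ce' eb ec' ee' bc' be' c'e'.
all: by rewrite [a == c']eq_sym c'a [a == e']eq_sym e'a.
Qed.

Lemma pentagons_deg2 (d d' : dart) : (val d).1 = (val d').1 -> d <> d' ->
  deg (val d).1 = 2 -> face_length d = 5 -> face_length d' = 5 -> deg (val d).2 = 2.
Proof.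
move=> same_base ne deg2 pentagon pentagon'.
have period := face_vertex_period d; have period' := face_vertex_period d'.
rewrite pentagon in period; rewrite pentagon' in period'.
set v := face_vertex d in period; set v' := face_vertex d' in period'.
have v_adj i : adj (v i) (v i.+1) by apply: face_vertex_adj.
have v'_adj i : adj (v' i) (v' i.+1) by apply: face_vertex_adj.
have v0 : v' 0 = v 0 by rewrite /v /face_vertex /= same_base.
have v1 : v 1 != v' 1.
  apply: contra_notN ne => /eqP v1; apply: val_inj.
  by rewrite [LHS]surjective_pairing [RHS]surjective_pairing same_base; congr (_, _).
have nbr y : adj (v 0) y -> y = v 1 \/ y = v' 1.
  by apply: deg2_nbr => //; rewrite -v0.
have v4 : v 4 = v' 1.
  have := nbr (v 4); rewrite adj_sym -{1}(period 0) => /(_ (v_adj 4))[v4|//].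
  by have := face_vertex_neq2 d 4; rewrite -/v (period 1) v4 eqxx.
have v'4 : v' 4 = v 1.
  have := nbr (v' 4); rewrite adj_sym -v0 -{1}(period' 0) => /(_ (v'_adj 4))[//|v'4].
  by have := face_vertex_neq2 d' 4; rewrite -/v' (period' 1) v'4 eqxx.
have := pentagon_uniq pentagon; have := pentagon_uniq pentagon'.
rewrite -/v -/v' v0 v4 v'4 => uniq' uniq5.
have v3_v'1 : adj (v 3) (v' 1) by rewrite -v4.
have v'3_v1 : adj (v' 3) (v 1) by rewrite -v'4.
have [v2 _] := glued_pentagons uniq5 uniq' (v_adj 1) (v_adj 2) v3_v'1 (v'_adj 1)
  (v'_adj 2) v'3_v1.
rewrite -[(val d).2]/(v 1); apply: (@prev_swap_deg _ (v 0) (v 2));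
  first by rewrite adj_sym.
  exact: esym (face_vertex_prev d 0).
by have := face_vertex_prev d' 3; rewrite -/v' v'4 v2 (period' 0) v0.
Qed.

Lemma pentagon_unique (d d' : dart) : (val d).1 = (val d').1 -> d <> d' ->
  deg (val d).1 = 2 -> face_length d = 5 -> face_length d' = 5 -> False.
Proof.
move=> same_base ne deg2 pentagon pentagon'.
have low x : deg x = 2 -> ~~ high x by rewrite /high => ->.
have nbr_low := pentagons_deg2 same_base ne deg2 pentagon pentagon'.
have nbr_low' := pentagons_deg2 (esym same_base) (nesym ne).
rewrite -same_base in nbr_low'; have {}nbr_low' := nbr_low' deg2 pentagon' pentagon.
have /card_gt0P[y] := low_high_degree (low _ deg2); rewrite inE => /andP[ay].
have nbrs : (val d).2 != (val d').2.
  apply: contra_notN ne => /eqP heads; apply: val_inj.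
  by rewrite [LHS]surjective_pairing [RHS]surjective_pairing same_base heads.
have adj' : adj (val d).1 (val d').2 by rewrite same_base; apply: (valP d').
by case: (deg2_nbr deg2 (valP d) adj' nbrs ay) => ->; apply/negP/low.
Qed.

Local Open Scope ring_scope.

(* Vertices start with charge 28 deg - 84 and faces with 14 length - 84, so that
   the total is 84 (E - V - F). A vertex of degree at least 42 can give 26 along
   each incident edge: to the other end if it is low ([high_transfer]), and
   otherwise to a face at this edge. [face_share d] is what the first vertex of
   [d] gives to the face of [d]. *)
Definition face_share (d : dart) : int :=
  let x := (val d).1 in let y := (val d).2 in
  if high x then (if high y then 26 else 0)
  else if deg x == 2 then
    if high_degree x == 1%N then (if face_length d == 5 then 0 else - 2)
    else (if face_length d == 5 then 14 else 0)
  else if high_degree x == 1%N then 7 else 14.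

Definition high_transfer (x : G) : int :=
  \sum_(y | adj x y) 26 * ((~~ high x && high y)%:Z - (high x && ~~ high y)%:Z).

Lemma sum_high_transfer : \sum_x high_transfer x = 0.
Proof.
have swap : \sum_(x : G) high_transfer x = - \sum_(x : G) high_transfer x.
  rewrite -sumrN {1}/high_transfer (exchange_big_dep xpredT) //=.
  apply: eq_bigr => y _; rewrite -sumrN; apply: eq_big => x; first exact: adj_sym.
  by rewrite -mulrN opprB; do 2![case: (high _)].
by lia.
Qed.

Lemma deg_split x :
  deg x = (high_degree x + #|[pred y | adj x y && ~~ high y]|)%N.
Proof.
by rewrite /deg -(cardID high); congr addn; apply: eq_card => y; rewrite !inE andbC.
Qed.

Lemma sum_adj_card x (P : pred G) (c : int) :
  \sum_(y | adj x y) c * (P y)%:Z = c * #|[pred y | adj x y && P y]|%:Z.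
Proof.
rewrite -mulr_sumr; congr (_ * _); rewrite -natz -sum1_card natr_sum big_mkcondr /=.
by apply: eq_bigr => y _; case: (P y).
Qed.

Lemma high_vertex_charge x : high x -> \sum_(d : dart | (val d).1 == x) face_share d <=
  28 * (deg x)%:Z - 84 + high_transfer x.
Proof.
move=> high_x; rewrite (eq_bigr (fun d : dart => 26 * (high (val d).2)%:Z)); last first.
  by move=> d /eqP xE; rewrite /face_share xE high_x; case: high.
rewrite (big_darts_at _ x (fun y => 26 * (high y)%:Z)) sum_adj_card.
have -> : high_transfer x = \sum_(y | adj x y) - 26 * (~~ high y)%:Z.
  by apply: eq_bigr => y _; rewrite high_x sub0r mulrN mulNr.
rewrite sum_adj_card -/(high_degree x); have := deg_split x.
by move: high_x; rewrite /high; lia.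
Qed.

Lemma low_high_transfer x : ~~ high x -> high_transfer x = 26 * (high_degree x)%:Z.
Proof.
move=> low_x; rewrite -sum_adj_card; apply: eq_bigr => y _.
by rewrite low_x (negPf low_x) subr0.
Qed.

Lemma sum_darts_const x (c : int) :
  \sum_(d : dart | (val d).1 == x) c = c * (deg x)%:Z.
Proof. by rewrite (big_darts_at _ x (fun=> c)) sumz_const. Qed.

Lemma low_vertex_charge x : ~~ high x -> (2 < deg x)%N ->
  \sum_(d : dart | (val d).1 == x) face_share d <=
  28 * (deg x)%:Z - 84 + high_transfer x.
Proof.
move=> low_x deg_x; have := low_high_degree low_x.
rewrite low_high_transfer // (eq_bigr (fun=> if high_degree x == 1%N then 7 else 14)).
  by rewrite sum_darts_const; case: eqP => ?; lia.
by move=> d /eqP xE; rewrite /face_share xE (negPf low_x) [_ == 2%N]gtn_eqF.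
Qed.

Lemma pentagons_at_deg2 x : deg x = 2%N ->
  (#|[pred d : dart | ((val d).1 == x) && (face_length d == 5)]| <= 1)%N.
Proof.
move=> deg2; rewrite leqNgt; apply/negP => /card_gt1P [d [d' []]].
rewrite !inE => /andP[/eqP dE /eqP pentagon] /andP[/eqP d'E /eqP pentagon'] /eqP ne.
by apply: (pentagon_unique (d := d) (d' := d')); rewrite ?dE ?d'E.
Qed.

Lemma deg2_vertex_charge x : deg x = 2%N ->
  \sum_(d : dart | (val d).1 == x) face_share d <=
  28 * (deg x)%:Z - 84 + high_transfer x.
Proof.
move=> deg2; have low_x : ~~ high x by rewrite /high deg2.
have := low_high_degree low_x; have := pentagons_at_deg2 deg2.
rewrite low_high_transfer //; set pentagons := [pred d | _].
have sum_pentagons (c : int) : \sum_(d : dart | (val d).1 == x)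
    (if face_length d == 5 then c else 0) = c * #|pentagons|%:Z.
  by rewrite -big_mkcondr sumz_const.
case: (eqVneq (high_degree x) 1%N) => [high1|high_ge2].
  rewrite (eq_bigr (fun d => - 2 + (if face_length d == 5 then 2 else 0))).
    by rewrite big_split /= sum_darts_const sum_pentagons; lia.
  move=> d /eqP xE; rewrite /face_share xE (negPf low_x) deg2 high1 /=.
  by case: ifP.
rewrite (eq_bigr (fun d => if face_length d == 5 then 14 else 0)).
  by rewrite sum_pentagons; lia.
by move=> d /eqP xE; rewrite /face_share xE (negPf low_x) deg2 (negPf high_ge2).
Qed.

Lemma vertex_charge x : \sum_(d : dart | (val d).1 == x) face_share d <=
  28 * (deg x)%:Z - 84 + high_transfer x.
Proof.
have [|low_x] := boolP (high x); first exact: high_vertex_charge.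
case: (ltngtP (deg x) 2) => [|deg_gt2|]; last exact: deg2_vertex_charge.
  by rewrite ltnNge deg_ge2.
exact: low_vertex_charge.
Qed.

Lemma long_face_charge d : (7 <= face_length d)%N ->
  0 <= 14 * (face_length d)%:Z - 84 + \sum_(d' <- orbit next d) face_share d'.
Proof.
move=> long.
have : - 2 * (face_length d)%:Z <= \sum_(d' <- orbit next d) face_share d'.
  have -> : - 2 * (face_length d)%:Z = \sum_(d' <- orbit next d) (- 2).
    rewrite big_const_seq count_predT size_orbit iter_addr addr0.
    by rewrite -[RHS]mulr_natr (natz (face_length d)).
  by apply: ler_sum => d' _; rewrite /face_share; do ![case: ifP => _].
lia.
Qed.

Definition pentagon_share (x_high x_deg2 pred_high succ_high : bool) : nat :=
  if x_high then (if succ_high then 26 else 0)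
  else if pred_high && succ_high then 14 else if x_deg2 then 0 else 7.

Lemma pentagon_share_le (d : dart) u : face_length d = 5%N ->
  adj (val d).1 u -> u != (val d).2 ->
  (pentagon_share (high (val d).1) (deg (val d).1 == 2) (high u) (high (val d).2))%:Z
    <= face_share d.
Proof.
move=> pentagon xu uy; rewrite /face_share pentagon eqxx /pentagon_share.
case: (high (val d).1) => /=; first by case: high.
have xy : adj (val d).1 (val d).2 by apply: (valP d).
case: (boolP (high u && high (val d).2)) => [/andP[high_u high_y]|_]; last first.
  by case: (deg _ == _); case: (high_degree _ == _).
have : (#|[set u; (val d).2]| <= high_degree (val d).1)%N.
  by apply/subset_leq_card/subsetP => z; rewrite !inE => /orP[] /eqP->; rewrite ?xu ?xy.
by rewrite cards2 uy => /gtn_eqF->; case: ifP.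
Qed.

Lemma pentagon_nbr_high (d : dart) u : adj (val d).1 u -> u != (val d).2 ->
  [|| high (val d).1, deg (val d).1 != 2%N, high u | high (val d).2].
Proof.
move=> xu uy; have [//|low_x] := boolP (high (val d).1).
have [deg2|//] := eqVneq (deg (val d).1) 2%N.
have /card_gt0P[y] := low_high_degree low_x; rewrite inE => /andP[xy].
by have [->|->] := deg2_nbr deg2 xu (valP d) uy xy => -> //; rewrite orbT.
Qed.

(* Two adjacent high vertices yield 26, and a vertex between two high ones yields
   14; otherwise at least two vertices have no high neighbour on the pentagon, so
   that they have degree at least 3 and yield 7 each. *)
Lemma pentagon_share_sum (h0 h1 h2 h3 h4 t0 t1 t2 t3 t4 : bool) :
  [|| h0, ~~ t0, h4 | h1] -> [|| h1, ~~ t1, h0 | h2] -> [|| h2, ~~ t2, h1 | h3] ->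
  [|| h3, ~~ t3, h2 | h4] -> [|| h4, ~~ t4, h3 | h0] ->
  (14 <= pentagon_share h0 t0 h4 h1 + pentagon_share h1 t1 h0 h2 +
         pentagon_share h2 t2 h1 h3 + pentagon_share h3 t3 h2 h4 +
         pentagon_share h4 t4 h3 h0)%N.
Proof.
by case: h0; case: h1; case: h2; case: h3; case: h4; case: t0; case: t1; case: t2;
  case: t3; case: t4.
Qed.

Lemma pentagon_charge d : face_length d = 5%N ->
  0 <= 14 * (face_length d)%:Z - 84 + \sum_(d' <- orbit next d) face_share d'.
Proof.
move=> pentagon; have period i := face_vertex_period d i; rewrite pentagon in period.
set v := face_vertex d in period.
have dart_prev i : adj (v i.+1) (v i) by rewrite adj_sym; apply: face_vertex_adj.
have share_le i : (pentagon_share (high (v i.+1)) (deg (v i.+1) == 2) (high (v i))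
    (high (v i.+2)))%:Z <= face_share (iter i.+1 next d).
  by apply: pentagon_share_le (dart_prev i) (face_vertex_neq2 _ _);
    rewrite face_length_iter.
have nbr_high i :
    [|| high (v i.+1), deg (v i.+1) != 2%N, high (v i) | high (v i.+2)].
  exact: (@pentagon_nbr_high (iter i.+1 next d) _ (dart_prev i) (face_vertex_neq2 _ _)).
have iter5 : iter 5 next d = d by rewrite -pentagon iter_order //; apply: face_next_inj.
have := share_le 4; move: (share_le 0) (share_le 1) (share_le 2) (share_le 3).
move: (nbr_high 0) (nbr_high 1) (nbr_high 2) (nbr_high 3) (nbr_high 4).
rewrite (period 0 : v 5 = v 0) (period 1 : v 6 = v 1) iter5.
move=> high1 high2 high3 high4 high0.
have := pentagon_share_sum high0 high1 high2 high3 high4.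
rewrite /orbit -/(face_length d) pentagon /= !big_cons big_nil.
by do 5![move: (pentagon_share _ _ _ _) => ?]; do 5![move: (face_share _) => ?]; lia.
Qed.

Lemma face_charge d :
  0 <= 14 * (face_length d)%:Z - 84 + \sum_(d' <- orbit next d) face_share d'.
Proof. by case: (face_lengthP d) => [/pentagon_charge|/long_face_charge]. Qed.

Lemma sum_vertex_charge :
  \sum_d face_share d <= 56 * #|oriented G|%:Z - 84 * #|G|%:Z.
Proof.
rewrite (partition_big (fun d : dart => (val d).1) xpredT) //=.
apply: le_trans (ler_sum _ (fun x _ => vertex_charge x)) _.
have -> : 84 * #|G|%:Z = \sum_(x : G) 84 by rewrite sumz_const.
rewrite big_split /= sum_high_transfer addr0 sumrB lerD2r -mulr_sumr.
have -> : \sum_(x : G) (deg x)%:Z = (\sum_(x : G) deg x)%:Z.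
  by rewrite -[RHS]natz natr_sum; apply: eq_bigr => x _; rewrite natz.
by rewrite handshake; lia.
Qed.

Lemma sum_face_charge :
  0 <= 28 * #|oriented G|%:Z - 84 * (fcard next {: dart})%:Z + \sum_d face_share d.
Proof.
have sum_length : \sum_(r | r \in froots next) (face_length r)%:Z =
    (#|oriented G|.*2)%:Z.
  rewrite -card_dart -[RHS]mul1r -sumz_const (big_orbits _ _ (@face_next_inj _ s)) /=.
  apply: eq_bigr => r _.
  by rewrite big_const_seq count_predT size_orbit iter_addr addr0 natz.
have -> : 28 * #|oriented G|%:Z = \sum_(r | r \in froots next) 14 * (face_length r)%:Z.
  by rewrite -mulr_sumr sum_length; lia.
have -> : 84 * (fcard next {: dart})%:Z = \sum_(r | r \in froots next) 84.
  rewrite sumz_const; congr (84 * _%:Z).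
  by apply: eq_card => d; rewrite !inE andbT.
rewrite (big_orbits _ _ (@face_next_inj _ s)) /= -sumrB -big_split /=.
by apply: sumr_ge0 => r _; apply: face_charge.
Qed.

Lemma not_separating : (0 < #|G|)%N -> ~ separating s.
Proof.
move=> G_gt0 /euler_inequality/(_ G_gt0).
by have := sum_vertex_charge; have := sum_face_charge; lia.
Qed.

End Discharging.

(** * Planar graphs without cycles of length 3, 4, 6 *)

Definition coloring (D : nat) (G : sgraph) (I : pred G) : Prop :=
  (forall x y, adj x y -> I x -> I y -> False) /\
  (forall x, ~~ I x -> #|[pred y | adj x y && ~~ I y]| <= D).

Lemma colorableP (D : nat) (G : sgraph) :
  colorable [tuple 0; D] G <-> exists I : pred G, coloring D I.
Proof.
split=> [[c c_bound]|[I [indep bounded]]].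
  have neq0 (z : G) : (c z != ord0) = (c z == ord_max).
    by case: (c z) => -[|[|//]] lt2; rewrite -!val_eqE.
  exists (fun x => c x == ord0); split=> [x y axy /eqP cx /eqP cy|x].
    have := c_bound ord0 x cx; rewrite (tnth_nth 0) /= leqn0 => /eqP/card0_eq/(_ y).
    by rewrite !inE axy cy eqxx.
  rewrite neq0 => /eqP cx; have := c_bound ord_max x cx; rewrite (tnth_nth 0) /=.
  by apply: leq_trans; apply: eq_leq; apply: eq_card => y; rewrite !inE neq0.
exists (fun x => if I x then ord0 else ord_max) => i v; case: ifP => Iv <-.
  rewrite (tnth_nth 0) /= leqn0; apply/eqP/eq_card0 => y; rewrite !inE.
  by apply/negP => /andP[avy]; case: ifP => // Iy; case: (indep _ _ avy Iv Iy).
rewrite (tnth_nth 0) /=; apply: leq_trans (bounded v (negbT Iv)).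
by apply/subset_leq_card/subsetP => y; rewrite !inE => /andP[->]; case: (I y).
Qed.

Lemma coloring_restrict D (G H : sgraph) (f : H -> G) (I : pred G) : injective f ->
  (forall x y, adj x y -> adj (f x) (f y)) -> coloring D I ->
  coloring D (fun x => I (f x)).
Proof.
move=> f_inj f_adj [indep bounded]; split=> [x y /f_adj|x /bounded]; first exact: indep.
apply: leq_trans; rewrite -(card_imset _ f_inj); apply/subset_leq_card/subsetP => z.
by case/imsetP=> y; rewrite !inE => /andP[/f_adj xy Iy] ->; rewrite xy.
Qed.

Section DeleteVertex.
Variables (G : sgraph) (v : G).

Definition delete_adj : rel {x : G | x != v} := fun x y => adj (val x) (val y).

Lemma delete_adj_sym : symmetric delete_adj.
Proof. by move=> x y; apply: adj_sym. Qed.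

Lemma delete_adj_irrefl : irreflexive delete_adj.
Proof. by move=> x; apply: adj_irrefl. Qed.

Definition delete_vertex : sgraph := SGraph delete_adj_sym delete_adj_irrefl.

Lemma card_delete_vertex : #|delete_vertex| < #|G|.
Proof.
rewrite /= card_sig; have -> : #|[pred x | x != v]| = #|G|.-1 by rewrite -(cardC1 v).
by rewrite ltn_predL; apply/card_gt0P; exists v.
Qed.

Lemma delete_vertex_subgraph (H : sgraph) :
  has_subgraph delete_vertex H -> has_subgraph G H.
Proof.
case=> f f_inj f_adj; exists (fun x => val (f x)); last exact: f_adj.
by move=> x y /val_inj/f_inj.
Qed.

Lemma delete_vertex_planar (R : realType) : planar R G -> planar R delete_vertex.
Proof.
case=> pos [arc [pos_inj arcP arc_vertex arc_cross]].
pose f (x : delete_vertex) : G := val x; have f_inj : injective f by apply: val_inj.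
have f_edge (x y : delete_vertex) : f @: [set x; y] = [set f x; f y].
  by rewrite imsetU1 imset_set1.
exists (fun x => pos (f x)), (fun e : {set delete_vertex} => arc (f @: e)); split.
- by move=> x y /pos_inj/f_inj.
- by move=> x y axy; rewrite f_edge; apply: arcP.
- by move=> x y z axy; rewrite f_edge; apply: arc_vertex.
- move=> x y x' y' axy axy' ne; rewrite !f_edge; apply: arc_cross => //.
  by rewrite -!f_edge => /(imset_inj f_inj).
Qed.

End DeleteVertex.

Definition coloring_except (D : nat) (G : sgraph) (v : G) (I : pred G) : Prop :=
  (forall x y, x != v -> y != v -> adj x y -> I x -> I y -> False) /\
  (forall x, x != v -> ~~ I x -> #|[pred y | [&& adj x y, y != v & ~~ I y]]| <= D).

Lemma delete_vertex_coloring D (G : sgraph) (v : G) (I : pred (delete_vertex v)) :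
  coloring D I -> exists J : pred G, coloring_except D v J.
Proof.
case=> indep bounded; pose J x := if insub x is Some y then I y else false.
have JE x (xv : x != v) : J x = I (Sub x xv) by rewrite /J insubT.
exists J; split=> [x y xv yv axy|x xv]; rewrite !JE; first exact: indep.
move=> /bounded; apply: leq_trans.
rewrite -(card_imset _ (@val_inj _ _ (delete_vertex v))).
apply/subset_leq_card/subsetP => y; rewrite inE => /and3P[axy yv Jy].
by apply/imsetP; exists (Sub y yv) => //; rewrite !inE -JE Jy andbT.
Qed.

Definition critical (D : nat) (G : sgraph) : Prop :=
  (forall I : pred G, ~ coloring D I) /\
  (forall v : G, exists I : pred G, coloring_except D v I).

Lemma hereditary_coloring (P : sgraph -> Prop) D :
  (forall (G : sgraph) (v : G), P G -> P (delete_vertex v)) ->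
  (forall G, P G -> ~ critical D G) ->
  forall G : sgraph, P G -> exists I : pred G, coloring D I.
Proof.
move=> P_delete P_noncritical G; have [m] := ubnP #|G|.
elim: m G => // m IH G; rewrite ltnS => G_le PG.
apply: contrapT => uncolorable; apply: (P_noncritical G PG); split=> [I col|v].
  by apply: uncolorable; exists I.
have [|I] := IH (delete_vertex v) _ (P_delete _ _ PG).
  exact: leq_trans (card_delete_vertex v) G_le.
exact: delete_vertex_coloring.
Qed.

Section Extend.
Variables (D : nat) (G : sgraph) (v : G) (I : pred G).
Hypothesis no_C3 : ~ has_subgraph G (cycle_graph 3).
Hypothesis colored : coloring_except D v I.

Lemma extend_independent : (forall w, adj v w -> ~~ I w) ->
  coloring D (fun x => (x == v) || I x).
Proof.
have [indep bounded] := colored; move=> nbr_out; split=> [x y|x].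
  case: (eqVneq x v) => [->|xv]; case: (eqVneq y v) => [->|yv] //=.
  - by rewrite adj_irrefl.
  - by move=> /nbr_out/negPf->.
  - by rewrite adj_sym => /nbr_out/negPf->.
  - exact: indep.
rewrite negb_or => /andP[xv Ix]; apply: leq_trans (bounded x xv Ix).
by apply/subset_leq_card/subsetP => y; rewrite !inE negb_or.
Qed.

Hypothesis nbr_low : forall w, adj v w -> ~~ I w -> deg w <= D.+1.

Let outside x := [set y | [&& adj x y, y != v & ~~ I y]].

(* The neighbours of [v] that become overfull when [v] leaves [I]; they are moved
   into [I] instead. *)
Let full w := [&& adj v w, ~~ I w & D <= #|outside w|].

Lemma full_nbr x y : full x -> adj x y -> y != v -> ~~ I y.
Proof.
move=> /and3P[avx Ix full_x] axy yv; apply/negP => Iy.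
have : #|v |: (y |: outside x)| <= deg x.
  apply/subset_leq_card/subsetP => z; rewrite !inE.
  by case/or3P=> [/eqP->|/eqP->//|/and3P[]//]; rewrite adj_sym.
rewrite !cardsU1 !inE eqxx Iy andbF (eq_sym v) yv /= !andbF.
by have := nbr_low avx Ix; move: (deg x) full_x => n; lia.
Qed.

Lemma recolor_independent x y :
  (x != v) && (I x || full x) -> (y != v) && (I y || full y) -> ~~ adj x y.
Proof.
have [indep _] := colored.
move=> /andP[xv Ix] /andP[yv Iy]; apply/negP => axy.
have [full_x|nfull_x] := boolP (full x).
  move: Iy; rewrite (negPf (full_nbr full_x axy yv)) /= => /and3P[avy _ _].
  have /and3P[avx _ _] := full_x.
  by apply/no_C3/(triangle_has_subgraph avx axy); rewrite adj_sym.
rewrite (negPf nfull_x) orbF in Ix.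
have [full_y|nfull_y] := boolP (full y).
  by have := full_nbr full_y _ xv; rewrite Ix adj_sym => /(_ axy).
by rewrite (negPf nfull_y) orbF in Iy; apply: indep xv yv axy Ix Iy.
Qed.

Lemma extend_low w0 : adj v w0 -> I w0 -> deg v <= D.+1 ->
  coloring D (fun x => (x != v) && (I x || full x)).
Proof.
have [_ bounded] := colored; move=> avw0 Iw0 deg_v; split=> [x y axy Ix Iy|x].
  by have := recolor_independent Ix Iy; rewrite axy.
have [-> _|xv /=] := eqVneq x v.
  rewrite -ltnS; apply: leq_trans deg_v; rewrite [deg v](cardD1 w0) inE avw0 add1n ltnS.
  apply/subset_leq_card/subsetP => y; rewrite !inE negb_and negb_or negbK => /andP[avy].
  rewrite avy andbT [y == v]eq_sym (negPf (adj_neq avy)) /= => /andP[Iy _].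
  by apply: contraNneq Iy => ->.
rewrite negb_or => /andP[Ix nfull].
have outside_le : #|[pred y | adj x y && ~~ ((y != v) && (I y || full y))]| <=
    adj x v + #|outside x|.
  rewrite -[leqLHS]cardsE.
  apply: (@leq_trans #|[set y in [set v] | adj x y] :|: outside x|).
    apply/subset_leq_card/subsetP => y; rewrite !inE negb_and negb_or negbK.
    by case: eqP => [_|_ /and3P[-> ->]] //=; rewrite andbT => ->.
  apply: leq_trans (leq_card_setU _ _).1 _; rewrite leq_add2r.
  case: (boolP (adj x v)) => [_|/negPf nxv].
    by rewrite -[leqRHS](cards1 v); apply/subset_leq_card/subsetP => y;
      rewrite !inE => /andP[].
  by rewrite leqn0 cards_eq0; apply/eqP/setP => y; rewrite !inE; case: eqP => //= ->.
apply: leq_trans outside_le _.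
case: (boolP (adj x v)) => [axv|_] /=; last by rewrite cardsE; apply: bounded.
by move: nfull; rewrite /full adj_sym axv Ix -ltnNge.
Qed.

End Extend.

(* A neighbour in [I] and a neighbour of large degree outside [I] are both
   obstacles to extending a coloring [I] of the other vertices to [v]. *)
Lemma critical_low_vertex D (G : sgraph) (v : G) : critical D G ->
  ~ has_subgraph G (cycle_graph 3) -> deg v <= D.+1 ->
  exists u w, [/\ u != w, adj v u, adj v w & D.+1 < deg w].
Proof.
move=> [uncolorable except] no_C3 deg_v; have [I colored] := except v.
have [all_out|/existsNP[u /not_implyP[avu /negP]]] :=
  pselect (forall u, adj v u -> ~~ I u).
  by case: (uncolorable _ (extend_independent colored all_out)).
rewrite negbK => Iu.
have [all_low|/existsNP[w /not_implyP[avw /not_implyP[Iw /negP]]]] :=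
    pselect (forall w, adj v w -> ~~ I w -> deg w <= D.+1).
  by case: (uncolorable _ (extend_low no_C3 colored all_low avu Iu deg_v)).
by rewrite -ltnNge => deg_w; exists u, w; split=> //; apply: contraNneq Iw => <-.
Qed.

Lemma critical_deg_ge2 D (G : sgraph) (v : G) : critical D G ->
  ~ has_subgraph G (cycle_graph 3) -> 2 <= deg v.
Proof.
move=> crit no_C3; rewrite leqNgt; apply/negP => deg_v.
have [|u [w [uw avu avw _]]] := critical_low_vertex crit no_C3 (v := v).
  exact: (@leq_trans 1).
have : #|[set u; w]| <= deg v.
  by apply/subset_leq_card/subsetP => z; rewrite !inE => /orP[] /eqP->.
by rewrite cards2 uw leqNgt deg_v.
Qed.

Definition planar_no346 (R : realType) (G : sgraph) : Prop :=
  [/\ planar R G, ~ has_subgraph G (cycle_graph 3), ~ has_subgraph G (cycle_graph 4) &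
      ~ has_subgraph G (cycle_graph 6)].

Lemma planar_no346_delete_vertex (R : realType) (G : sgraph) (v : G) :
  planar_no346 R G -> planar_no346 R (delete_vertex v).
Proof.
by case=> planarG no_C3 no_C4 no_C6; split;
  [apply: delete_vertex_planar | move/delete_vertex_subgraph..].
Qed.

Lemma planar_no346_noncritical (R : realType) (G : sgraph) :
  planar_no346 R G -> ~ critical 40 G.
Proof.
case=> planarG no_C3 no_C4 no_C6 crit.
have [s sep] := planar_separating_rotation planarG.
apply: (not_separating no_C3 no_C4 no_C6 _ _ _ sep) => [v|v|].
- exact: critical_deg_ge2 crit no_C3.
- rewrite -ltnNge => deg_v; apply/card_gt0P.
  have [u [w [_ _ avw deg_w]]] := critical_low_vertex crit no_C3 deg_v.
  by exists w; rewrite inE avw.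
- rewrite lt0n; apply/eqP => /card0_eq G0; have [uncolorable _] := crit.
  by apply: (uncolorable predT); split=> x; have := G0 x.
Qed.

Lemma planar_no346_coloring (R : realType) (G : sgraph) :
  planar_no346 R G -> exists I : pred G, coloring 40 I.
Proof.
apply: hereditary_coloring; first exact: planar_no346_delete_vertex.
exact: planar_no346_noncritical.
Qed.

(** * Graphs without odd cycles *)

Lemma odd_closed_walk_uniq (T : eqType) (e : rel T) (q : seq T) :
  cycle e q -> odd (size q) -> exists p, [/\ uniq p, cycle e p & odd (size p)].
Proof.
have [m] := ubnP (size q); elim: m q => // m IH q; rewrite ltnS => q_le q_cycle q_odd.
have [q_uniq|] := boolP (uniq q); first by exists q.
have x0 : T by case: q q_odd {q_le q_cycle} => [|x].
case/(uniqPn x0) => i [j [ij jq nth_ij]].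
pose y := nth x0 q i; pose a := take (j - i).-1 (drop i.+1 q).
pose b := drop (j - i) (drop i.+1 q) ++ take i q.
have rot_q : rot i q = (y :: a) ++ (y :: b).
  have iq : i < size q by apply: ltn_trans ij jq.
  rewrite /rot (drop_nth x0 iq) -/y /= /a /b; congr (_ :: _).
  rewrite -[in LHS](cat_take_drop (j - i).-1 (drop i.+1 q)) -catA; congr (_ ++ _).
  rewrite (drop_nth x0) ?nth_drop ?size_drop; last by lia.
  have -> : i.+1 + (j - i).-1 = j by lia.
  by rewrite -nth_ij -/y (_ : (j - i).-1.+1 = j - i); last lia.
have size_q : size a + size b + 2 = size q.
  by rewrite -(size_rot i q) rot_q size_cat /=; lia.
move: q_cycle; rewrite -(rot_cycle i) rot_q /= rcons_cat cat_path /=.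
move=> /and3P[ya ay yb].
have cycle_a : cycle e (y :: a) by rewrite /= rcons_path ya ay.
have [odd_a|odd_b] : odd (size (y :: a)) \/ odd (size (y :: b)).
  by move: q_odd; rewrite -size_q /=; lia.
  by apply: IH cycle_a odd_a; rewrite /=; lia.
by apply: (IH (y :: b)) odd_b => //=; lia.
Qed.

Lemma odd_closed_walk_subgraph (G : sgraph) (q : seq G) : cycle adj q -> odd (size q) ->
  exists i, 1 <= i /\ has_subgraph G (cycle_graph (2 * i + 1)).
Proof.
move=> q_cycle q_odd.
have [p [p_uniq p_cycle p_odd]] := odd_closed_walk_uniq q_cycle q_odd.
exists (size p)./2; split; last first.
  have -> : 2 * (size p)./2 + 1 = size p by lia.
  exact: cycle_has_subgraph.
by case: p p_uniq p_cycle p_odd => [//|x [|y [|z p]]] //= _; rewrite adj_irrefl.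
Qed.

Section BipartiteCover.
Variable G : sgraph.

Definition cover_adj : rel (G * bool) := fun u v => adj u.1 v.1 && (v.2 == ~~ u.2).

Lemma cover_adj_flip (x y : G) b : adj x y -> connect cover_adj (x, b) (y, ~~ b).
Proof. by move=> xy; apply: connect1; rewrite /cover_adj /= xy eqxx. Qed.

Lemma cover_connect_sym : connect_sym cover_adj.
Proof.
apply: sym_connect_sym => -[x b] [y c]; rewrite /cover_adj /= adj_sym.
by case: b; case: c.
Qed.

Lemma connect_cover_walk u v : connect cover_adj u v ->
  exists p, [/\ path adj u.1 p, last u.1 p = v.1 & odd (size p) = u.2 (+) v.2].
Proof.
case/connectP=> p; elim: p u => [|w p IH] u /=.
  by move=> _ ->; exists [::]; rewrite /= addbb.
case/andP=> /andP[uw /eqP w2] /IH{}IH /IH[q [q_path q_last q_odd]].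
exists (w.1 :: q); rewrite /= uw q_path q_last q_odd w2; split=> //.
by case: u.2; case: v.2.
Qed.

Lemma walk_cover_connect x p b : path adj x p ->
  connect cover_adj (x, b) (last x p, b (+) odd (size p)).
Proof.
elim: p x b => [|y p IH] x b /=; first by rewrite addbF.
case/andP=> xy y_p; apply: connect_trans (cover_adj_flip b xy) _.
by rewrite addbN -addNb; apply: IH.
Qed.

Lemma cover_sheets_disconnected x :
  (forall i, 1 <= i -> ~ has_subgraph G (cycle_graph (2 * i + 1))) ->
  ~~ connect cover_adj (x, false) (x, true).
Proof.
move=> no_odd; apply/negP => /connect_cover_walk[p [/= x_p p_last p_odd]].
have p_cycle : cycle adj p.
  case: p x_p p_last p_odd => //= y p /andP[xy y_p] p_last _.
  by rewrite rcons_path y_p p_last.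
by have [i [/no_odd]] := odd_closed_walk_subgraph p_cycle p_odd.
Qed.

Lemma no_odd_cycle_coloring :
  (forall i, 1 <= i -> ~ has_subgraph G (cycle_graph (2 * i + 1))) ->
  exists I : pred G, coloring 0 I.
Proof.
move=> no_odd; pose base (x : G) := fingraph.root adj x.
pose I x := connect cover_adj (base x, false) (x, false).
have adj_connect_sym : connect_sym (@adj G) by apply: sym_connect_sym; apply: adj_sym.
have base_adj x y : adj x y -> base x = base y.
  by move=> xy; apply/eqP; rewrite root_connect // connect1.
have Ior x : I x \/ connect cover_adj (base x, false) (x, true).
  have : connect adj (base x) x by rewrite adj_connect_sym connect_root.
  case/connectP=> p base_p xE; have := walk_cover_connect false base_p.
  by rewrite -xE /I; case: (odd _); [right|left].
exists I; split=> [x y xy Ix Iy|x nIx].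
  have /negP[] := cover_sheets_disconnected y no_odd.
  move: Iy; rewrite /I cover_connect_sym => /connect_trans; apply.
  by rewrite -(base_adj _ _ xy); apply: connect_trans Ix (cover_adj_flip false xy).
rewrite leqn0; apply/eqP/eq_card0 => y; rewrite !inE.
apply/negP => /andP[xy /negP]; apply.
case: (Ior x) => [Ix|]; first by rewrite Ix in nIx.
rewrite (base_adj _ _ xy) => /connect_trans; apply.
exact: (cover_adj_flip true xy).
Qed.

End BipartiteCover.

(** * Two-page book embeddings *)

Section Tents.
Variable R : realType.
Local Open Scope ring_scope.
Local Open Scope classical_set_scope.
Implicit Types a b z : plane R.
Implicit Types i j t : R.

Lemma segmentP a b z : a.1 < b.1 ->
  segment a b z <-> (a.1 <= z.1 <= b.1) /\ z.2 = line a b z.1.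
Proof.
move=> ab; have ab_neq : a.1 != b.1 by rewrite lt_eqF.
have slope_def : b.1 - a.1 != 0 by rewrite subr_eq0 eq_sym.
split=> [[t t01 ->] /=|[ab_z zE]].
  by split; [nra | rewrite /line /slope; field].
have := segment_line ab_neq (x := z.1); rewrite /spans ab_z => /(_ isT).
by rewrite -zE -surjective_pairing.
Qed.

Lemma segmentC a b : segment a b = segment b a.
Proof.
suff sub (c d : plane R) : segment c d `<=` segment d c.
  by apply/seteqP; split; apply: sub.
by move=> z [t t01 ->]; exists (1 - t); [lra | congr (_, _); ring].
Qed.

Lemma polygonal_arc_bend a m b : a <> m -> m <> b ->
  segment a m `&` segment m b = [set m] ->
  polygonal_arc (segment a m `|` segment m b) a b.
Proof.
move=> am mb meet; exists 1%N, (nth b [:: a; m; b]); split=> //.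
- by case=> [|[|]].
- by case.
- by move=> i j; lia.
apply/seteqP; split=> z.
  by case=> seg; [exists 0%N | exists 1%N].
by case=> -[|[|]] //= _ seg; [left | right].
Qed.

(* The sides of a tent get steeper with its width, so that nested tents on the
   same side of the axis do not meet. *)
Definition apex i j (up : bool) : plane R :=
  ((i + j) / 2, (-1) ^+ (~~ up) * (j - i) ^+ 2).

Definition tent i j (up : bool) : set (plane R) :=
  segment (i, 0) (apex i j up) `|` segment (apex i j up) (j, 0).

Definition tent_height i j t : R := 2 * (j - i) * Num.min (t - i) (j - t).

Lemma tent_leftP i j up z : i < j -> segment (i, 0) (apex i j up) z <->
  (i <= z.1 <= (i + j) / 2) /\ z.2 = (-1) ^+ (~~ up) * (2 * (j - i) * (z.1 - i)).
Proof.
move=> ij; rewrite segmentP /=; last lra.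
suff -> : line (i, 0) (apex i j up) z.1 =
    (-1) ^+ (~~ up) * (2 * (j - i) * (z.1 - i)) by [].
by rewrite /line /slope /=; field; lra.
Qed.

Lemma tent_rightP i j up z : i < j -> segment (apex i j up) (j, 0) z <->
  ((i + j) / 2 <= z.1 <= j) /\ z.2 = (-1) ^+ (~~ up) * (2 * (j - i) * (j - z.1)).
Proof.
move=> ij; rewrite segmentP /=; last lra.
suff -> : line (apex i j up) (j, 0) z.1 =
    (-1) ^+ (~~ up) * (2 * (j - i) * (j - z.1)) by [].
by rewrite /line /slope /=; field; lra.
Qed.

Lemma tent_heightP i j up z : i < j -> tent i j up z ->
  (i <= z.1 <= j) /\ z.2 = (-1) ^+ (~~ up) * tent_height i j z.1.
Proof.
move=> ij [/tent_leftP|/tent_rightP] /(_ ij)[ij_z ->]; split; try lra;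
  congr (_ * (_ * _)).
  by rewrite min_l //; lra.
by rewrite min_r //; lra.
Qed.

Lemma apexC i j up : apex i j up = apex j i up.
Proof. by rewrite /apex addrC -[j - i]opprB sqrrN. Qed.

Lemma tentC i j up : tent i j up = tent j i up.
Proof.
rewrite /tent apexC classical_sets.setUC.
by rewrite [segment (i, 0) _]segmentC [segment _ (j, 0)]segmentC.
Qed.

Lemma tent_sides_meet i j up : i != j ->
  segment (i, 0) (apex i j up) `&` segment (apex i j up) (j, 0) = [set apex i j up].
Proof.
wlog ij : i j / i < j => [wlog_lt|_].
  move=> neq; have [/wlog_lt|ji|eq_ij] := ltgtP i j; last by rewrite eq_ij eqxx in neq.
    exact.
  rewrite apexC classical_sets.setIC segmentC [segment (i, 0) _]segmentC.
  by apply: wlog_lt; rewrite // lt_eqF.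
apply/seteqP; split=> z; last first.
  by move=> ->; split; [apply: segment_right | apply: segment_left].
case=> /(tent_leftP _ _ ij)[left_z zE] /(tent_rightP _ _ ij)[right_z _] /=.
have z1 : z.1 = (i + j) / 2 by lra.
by rewrite /apex [z]surjective_pairing zE z1; congr (_, _ * _); field.
Qed.

Lemma tent_polygonal_arc i j up : i != j -> polygonal_arc (tent i j up) (i, 0) (j, 0).
Proof.
move=> ij; apply: polygonal_arc_bend; last exact: tent_sides_meet.
  by case=> eq_i _; move/eqP: ij; lra.
by case=> eq_j _; move/eqP: ij; lra.
Qed.

Lemma tent_height_gt0 i j t : i < t < j -> 0 < tent_height i j t.
Proof.
by move=> ijt; apply: mulr_gt0; [lra | rewrite lt_min; apply/andP; split; lra].
Qed.

Lemma tent_height_eq0 i j t : i < j -> i <= t <= j -> tent_height i j t = 0 ->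
  t = i \/ t = j.
Proof.
move=> ij ijt /eqP; rewrite mulf_eq0; case/orP=> /eqP; first by move=> ?; exfalso; lra.
by rewrite /Num.min; case: ifP => _ ?; [left|right]; lra.
Qed.

Lemma tent_height_lt i j i' j' t : i <= i' -> j' <= j -> i < i' \/ j' < j ->
  i' < t < j' -> tent_height i' j' t < tent_height i j t.
Proof.
move=> ii' j'j wider t_in; rewrite /tent_height.
have height_gt0 : 0 < Num.min (t - i') (j' - t).
  by rewrite lt_min; apply/andP; split; lra.
have height_le : Num.min (t - i') (j' - t) <= Num.min (t - i) (j - t).
  by rewrite le_min !ge_min; apply/andP; split; apply/orP; [left|right]; lra.
have width_lt : j' - i' < j - i by case: wider => ?; lra.
by nra.
Qed.

Lemma signed_pos_inj (up up' : bool) (s t : R) : 0 < s -> 0 <= t ->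
  (-1) ^+ (~~ up) * s = (-1) ^+ (~~ up') * t -> up = up' /\ s = t.
Proof. by case: up; case: up' => /= s0 t0; rewrite ?expr0 ?expr1; split=> //; lra. Qed.

Lemma tent_axis i j up z : i < j -> tent i j up z -> z.2 = 0 ->
  z = (i, 0) \/ z = (j, 0).
Proof.
move=> ij /(tent_heightP ij)[ij_z zE]; rewrite [z]surjective_pairing => /= z2.
move/esym/eqP: zE; rewrite z2 mulf_eq0 signr_eq0 /= => /eqP.
by case/(tent_height_eq0 ij ij_z) => ->; [left|right].
Qed.

Lemma tents_meet i j i' j' up up' z : i < j -> i' < j' ->
  tent i j up z -> tent i' j' up' z -> z.2 != 0 ->
  up = up' /\ [\/ i = i' /\ j = j', i < i' /\ (i' < j < j') | i' < i /\ (i < j' < j)].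
Proof.
move=> ij ij' /(tent_heightP ij)[ij_z zE] /(tent_heightP ij')[ij_z' zE'] z2.
have inner k l t : k <= t <= l -> tent_height k l t != 0 -> k < t < l.
  move=> /andP[kt tl]; rewrite !lt_neqAle kt tl !andbT => height_neq0.
  apply/andP; split; apply: contraNneq height_neq0; rewrite /tent_height => ->.
    by rewrite subrr min_l ?mulr0 // subr_ge0.
  by rewrite subrr min_r ?mulr0 // subr_ge0 (le_trans kt).
have {}ij_z : i < z.1 < j.
  by apply: inner => //; apply: contraNneq z2 => height0; rewrite zE height0 mulr0.
have {}ij_z' : i' < z.1 < j'.
  by apply: inner => //; apply: contraNneq z2 => height0; rewrite zE' height0 mulr0.
rewrite zE' in zE; have [||pages heights] := signed_pos_inj _ _ (esym zE).
- exact: tent_height_gt0.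
- by rewrite ltW // tent_height_gt0.
split=> //; have lt_ij' := @tent_height_lt i j i' j' z.1.
have lt_ij := @tent_height_lt i' j' i j z.1.
rewrite heights ltxx in lt_ij' lt_ij.
case: (ltgtP i i') => [ii'|i'i|ii'].
- case: (ltP j j') => [jj'|j'j]; first by constructor 2; split=> //; lra.
  by have := lt_ij' (ltW ii') j'j (or_introl ii') ij_z'.
- case: (ltP j' j) => [j'j|jj']; first by constructor 3; split=> //; lra.
  by have := lt_ij (ltW i'i) jj' (or_introl i'i) ij_z.
- case: (ltgtP j j') => [jj'|j'j|jj']; last by constructor 1.
    by have := lt_ij _ (ltW jj') (or_intror jj') ij_z; rewrite ii' lexx => /(_ isT).
  by have := lt_ij' _ (ltW j'j) (or_intror j'j) ij_z'; rewrite ii' lexx => /(_ isT).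
Qed.

End Tents.

Definition book_embedding (G : sgraph) (rho : G -> nat)
    (page : G -> G -> bool) : Prop :=
  [/\ injective rho, forall x y, page x y = page y x &
    forall x y z w, adj x y -> adj z w -> rho x < rho z -> rho z < rho y ->
      rho y < rho w -> page x y = page z w -> False].

Section BookDrawing.
Variables (R : realType) (G : sgraph) (rho : G -> nat) (page : G -> G -> bool).
Hypothesis book : book_embedding rho page.

Let pos (x : G) : plane R := ((rho x)%:R%R, 0%R).

Definition book_arc (e : {set G}) : set (plane R) := fun z =>
  exists x y, [/\ e = [set x; y], rho x < rho y &
    tent (rho x)%:R%R (rho y)%:R%R (page x y) z].

Lemma book_arcE x y : adj x y ->
  book_arc [set x; y] = tent (rho x)%:R%R (rho y)%:R%R (page x y).
Proof.
have [rho_inj pageC _] := book; move=> axy; apply/seteqP; split=> z.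
  case=> u [v [sets uv]].
  have : x \in [set u; v] /\ y \in [set u; v] by rewrite -sets !inE !eqxx orbT.
  rewrite !inE => -[/orP[] /eqP xE /orP[] /eqP yE];
    rewrite xE yE ?adj_irrefl // in axy *.
  by rewrite tentC pageC.
move=> tent_z; case: (ltngtP (rho x) (rho y)) => [xy|yx|/rho_inj xy].
- by exists x, y.
- by exists y, x; rewrite setUC tentC pageC.
- by rewrite xy adj_irrefl in axy.
Qed.

Lemma book_arc_endpoints e x y z : e = [set x; y] -> adj x y -> book_arc e z ->
  exists u v, [/\ e = [set u; v], adj u v, rho u < rho v &
    tent (rho u)%:R%R (rho v)%:R%R (page u v) z].
Proof.
move=> -> axy [u [v [sets uv tent_z]]]; exists u, v; split=> //.
have : u \in [set x; y] /\ v \in [set x; y] by rewrite sets !inE !eqxx orbT.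
rewrite !inE => -[/orP[] /eqP uE /orP[] /eqP vE]; rewrite uE vE ?ltnn // in uv *.
by rewrite adj_sym.
Qed.

Lemma book_plane_drawing : plane_drawing pos book_arc.
Proof.
have [rho_inj pageC nocross] := book.
have pos_inj : injective pos by move=> x y [] /eqP; rewrite eqr_nat => /eqP/rho_inj.
have rho_neq x y : adj x y -> ((rho x)%:R != (rho y)%:R :> R)%R.
  by move=> axy; rewrite eqr_nat (inj_eq rho_inj) adj_neq.
have ends x y u v z : [set x; y] = [set u; v] -> ~ [set pos x; pos y]%classic z ->
    z <> pos u /\ z <> pos v.
  move=> sets not_end; have : u \in [set x; y] /\ v \in [set x; y].
    by rewrite sets !inE !eqxx orbT.
  rewrite !inE => -[/orP[] /eqP-> /orP[] /eqP->]; split=> zE; apply: not_end;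
    rewrite zE; by [left | right].
split=> //.
- by move=> x y axy; rewrite book_arcE //; apply/tent_polygonal_arc/rho_neq.
- move=> x y w axy [/(book_arc_endpoints erefl axy)[u [v [sets _ uv tent_w]]]].
  move=> /(ends _ _ _ _ _ sets)[wu wv].
  by case: (tent_axis _ tent_w) => //; rewrite ltr_nat.
move=> x y x' y' axy axy' ne; apply/seteqP; split=> // z [[arc_z not_end] arc_z'].
have [u [v [sets auv uv tent_z]]] := book_arc_endpoints erefl axy arc_z.
have [u' [v' [sets' auv' uv' tent_z']]] := book_arc_endpoints erefl axy' arc_z'.
have [zu zv] := ends _ _ _ _ _ sets not_end.
have z2 : (z.2 != 0)%R.
  by apply/eqP => z2; case: (tent_axis _ tent_z z2) => //; rewrite ltr_nat.
have [||pages] := tents_meet _ _ tent_z tent_z' z2; rewrite ?ltr_nat //.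
case=> [[/eqP uu' /eqP vv']|[uu' /andP[u'v vv']]|[u'u /andP[uv'' v'v]]].
- apply: ne; rewrite sets sets'.
  by move: uu' vv'; rewrite !eqr_nat => /eqP/rho_inj-> /eqP/rho_inj->.
- by case: (nocross u v u' v').
- by case: (nocross u' v' u v).
Qed.

Lemma book_planar : planar R G.
Proof. by exists pos, book_arc; apply: book_plane_drawing. Qed.

End BookDrawing.

(** * Joining copies of a gadget at their roots *)

(* For [3 <= k], a parametrization of a cycle of length [k] in [G]. *)
Definition cycle_walk (G : sgraph) (k : nat) (f : nat -> G) : Prop :=
  (forall t, adj (f t) (f t.+1)) /\ (forall t u, (f t == f u) = (t == u %[mod k])).

Lemma subgraph_cycle_walk (G : sgraph) k : 3 <= k -> has_subgraph G (cycle_graph k) ->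
  exists f : nat -> G, cycle_walk k f.
Proof.
case: k => // k k3 [f f_inj f_adj]; exists (fun t => f (inord (t %% k.+1))).
have val_mod t : (inord (t %% k.+1) : 'I_k.+1) = t %% k.+1 :> nat.
  by rewrite inordK // ltn_pmod.
split=> t => [|u]; last by rewrite (inj_eq f_inj) -val_eqE /= !val_mod.
have succ : (t %% k.+1).+1 %% k.+1 = t.+1 %% k.+1 by rewrite -addn1 modnDml addn1.
have neq : t %% k.+1 != t.+1 %% k.+1.
  have := eqn_modDl t 0 1 k.+1; rewrite addn0 addn1 => ->.
  by rewrite !modn_small //; lia.
apply: f_adj; rewrite [adj _ _]/(cycle_adj _ _) /cycle_adj /= -!val_eqE /= !val_mod.
by rewrite neq succ eqxx.
Qed.

Definition cycle_lengths_in (G : sgraph) (L : nat -> Prop) : Prop :=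
  forall k (f : nat -> G), 3 <= k -> cycle_walk k f -> L k.

Definition rooted_book (G : sgraph) (r : G) : Prop :=
  exists rho page, book_embedding (G := G) rho page /\ forall x, rho r <= rho x.

Definition forced_in (D : nat) (G : sgraph) (r : G) : Prop :=
  forall I : pred G, coloring D I -> I r.

Definition forced_out (D : nat) (G : sgraph) (r : G) : Prop :=
  forall I : pred G, coloring D I -> ~~ I r.

Section JoinedCopies.
Variables (G : sgraph) (r : G) (N : nat).

(* Copies [0, ..., N] of [G]; the root of copy [0], the hub, is adjacent to the
   roots of the other copies. *)
Definition joined_adj : rel ('I_N.+1 * G) := fun u v =>
  (u.1 == v.1) && adj u.2 v.2 ||
  [&& u.2 == r, v.2 == r & (u.1 == ord0) (+) (v.1 == ord0)].

Lemma joined_adj_sym : symmetric joined_adj.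
Proof.
by move=> u v; rewrite /joined_adj eq_sym adj_sym addbC andbCA.
Qed.

Lemma joined_adj_irrefl : irreflexive joined_adj.
Proof. by move=> u; rewrite /joined_adj adj_irrefl addbb !andbF. Qed.

Definition joined_copies : sgraph := SGraph joined_adj_sym joined_adj_irrefl.

Definition hub : joined_copies := (ord0, r).

Lemma joined_adjP (u v : joined_copies) : adj u v ->
  [\/ u.1 = v.1 /\ adj u.2 v.2, u = hub /\ v.2 = r | v = hub].
Proof.
move: u v => [i x] [j y] /orP[/andP[/= /eqP-> xy]|/and3P[/= /eqP-> /eqP->]].
  by constructor 1.
rewrite /hub; case: (eqVneq i ord0) => [->|_]; first by constructor 2.
by case: (eqVneq j ord0) => [->|//]; constructor 3.
Qed.

Lemma joined_adj_copy (u v : joined_copies) :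
  adj u v -> u != hub -> v != hub -> u.1 = v.1.
Proof.
by case/joined_adjP=> [[]//|[-> _]|->]; rewrite eqxx.
Qed.

Lemma hub_adj_root (v : joined_copies) : adj hub v -> v.1 != ord0 -> v = (v.1, r).
Proof.
by move: v => [j y] /orP[/andP[/eqP<-]|/and3P[_ /= /eqP->]].
Qed.

(* The hub separates the copies, and its neighbours in copy [j != 0] reduce to the
   root of that copy. *)
Lemma joined_walk_copy k (f : nat -> joined_copies) : 3 <= k -> cycle_walk k f ->
  exists i, forall t, (f t).1 = i.
Proof.
move=> k3 [f_adj f_eq].
have [no_hub|/existsNP[t0 /negP/negPn/eqP t0_hub]] := pselect (forall t, f t != hub).
  by exists (f 0).1; elim=> // t <-; apply/esym/joined_adj_copy.
have off_hub u : 0 < u < k -> f (t0 + u) != hub.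
  by move=> u_bound; rewrite -t0_hub f_eq -[X in _ != X %[mod _]]addn0 eqn_modDl mod0n
    modn_small; lia.
pose j := (f (t0 + 1)).1.
have copy_j u : 0 < u < k -> (f (t0 + u)).1 = j.
  elim: u => // -[|u] IH u_bound //; rewrite -IH; last by lia.
  by rewrite [t0 + u.+2]addnS; apply/esym/joined_adj_copy => //; [|rewrite -addnS];
    apply: off_hub; lia.
have j0 : j = ord0.
  apply/eqP/negPn/negP => j_neq0.
  have next : f (t0 + 1) = (j, r).
    by apply: hub_adj_root => //; rewrite -t0_hub addn1.
  have prev : f (t0 + k.-1) = (j, r).
    have prev_j : (f (t0 + k.-1)).1 = j by apply: copy_j; lia.
    rewrite -prev_j; apply: hub_adj_root; last by rewrite prev_j.
    have -> : hub = f (t0 + k.-1).+1.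
      by rewrite -t0_hub -addnS prednK; [apply/esym/eqP; rewrite f_eq modnDr | lia].
    by rewrite adj_sym.
  have /eqP := etrans next (esym prev).
  by rewrite f_eq eqn_modDl !modn_small; lia.
exists ord0 => t; pose u := (t + k.-1 * t0) %% k.
have -> : f t = f (t0 + u).
  apply/eqP; rewrite f_eq /u modnDmr addnCA -mulSn prednK; last by lia.
  by rewrite addnC mulnC modnMDl.
have u_lt : u < k by rewrite ltn_pmod; lia.
case: (posnP u) => [->|u_gt0]; first by rewrite addn0 t0_hub.
by rewrite copy_j ?u_gt0.
Qed.

Lemma joined_copies_cycle_lengths L :
  cycle_lengths_in G L -> cycle_lengths_in joined_copies L.
Proof.
move=> G_lengths k f k3 walk; have [i copy_i] := joined_walk_copy k3 walk.
have [f_adj f_eq] := walk; apply: (G_lengths k (fun t => (f t).2) k3).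
split=> [t|t u].
  have /orP[/andP[_ //]|] := f_adj t.
  by rewrite !copy_i addbb !andbF.
rewrite -f_eq; apply/eqP/eqP => [snd_eq|->//].
by rewrite [LHS]surjective_pairing [RHS]surjective_pairing !copy_i snd_eq.
Qed.

Lemma joined_copies_book : rooted_book r -> rooted_book hub.
Proof.
move=> [rho [page [[rho_inj pageC nocross] r_min]]].
pose M := (\max_x rho x).+1.
have rho_lt x : rho x < M by rewrite ltnS; apply: leq_bigmax.
pose pos (u : joined_copies) := u.1 * M + rho u.2.
have pos_copy u : pos u %/ M = u.1 by rewrite divnMDl // divn_small ?addn0.
have copy_le u v : pos u < pos v -> u.1 <= v.1.
  by move=> /ltnW/(leq_div2r M); rewrite !pos_copy.
have pos_same (u v : joined_copies) :
    u.1 = v.1 -> (pos u < pos v) = (rho u.2 < rho v.2).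
  by move=> same; rewrite /pos same ltn_add2l.
have root_min (u v : joined_copies) : u.2 = r -> u.1 = v.1 -> pos u <= pos v.
  by move=> u_root same; rewrite /pos same u_root leq_add2l.
have hub_min u : pos hub <= pos u.
  by rewrite /pos mul0n; apply: leq_trans (r_min u.2) (leq_addl _ _).
exists pos, (fun u v => page u.2 v.2); split=> //.
split=> [u v pos_uv|u v|x y z w axy azw].
- have same : u.1 = v.1 by apply: ord_inj; rewrite -!pos_copy pos_uv.
  move: pos_uv; rewrite /pos same => /addnI/rho_inj snd_eq.
  by rewrite [LHS]surjective_pairing [RHS]surjective_pairing same snd_eq.
- exact: pageC.
move=> xz zy yw; case/joined_adjP: azw => [[zw_copy azw]|[z_hub _]|w_hub].
- have copies (u v u' : joined_copies) : pos u < pos v -> pos v < pos u' ->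
      u.1 = u'.1 -> v.1 = u.1.
    by move=> /copy_le uv /copy_le vu' same; apply/val_inj/anti_leq;
      rewrite uv andbT same.
  case/joined_adjP: axy => [[xy_copy axy]|[_ y_root]|y_hub].
  + have zx : z.1 = x.1 by apply: copies xz zy xy_copy.
    move: xz zy yw; rewrite !pos_same -?xy_copy -?zw_copy ?zx //;
      exact: nocross axy azw.
  + have yz : y.1 = z.1 by apply: copies zy yw zw_copy.
    by move: zy; rewrite ltnNge root_min.
  + by move: xz; rewrite ltnNge; move: zy; rewrite y_hub ltnNge hub_min.
- by move: xz; rewrite z_hub ltnNge hub_min.
- by move: yw; rewrite w_hub ltnNge hub_min.
Qed.

Lemma joined_coloring D (I : pred joined_copies) i :
  coloring D I -> coloring D (fun x => I (i, x)).
Proof.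
apply: coloring_restrict => [x y []//|x y xy].
by apply/orP; left; rewrite /= eqxx.
Qed.

Lemma hub_adj i : adj hub (lift ord0 i, r).
Proof. by apply/orP; right; rewrite /= !eqxx. Qed.

Lemma joined_not_colorable D : D < N -> forced_in D r \/ forced_out D r ->
  forall I : pred joined_copies, ~ coloring D I.
Proof.
move=> DN [forced|forced] I col; have [indep bounded] := col.
  have N_gt0 : 0 < N by apply: leq_ltn_trans DN.
  apply: indep (hub_adj (Ordinal N_gt0)) _ _; exact: forced _ (joined_coloring _ col).
have hub_out : ~~ I hub by apply: forced _ (joined_coloring _ col).
have root_inj : injective (fun i : 'I_N => (lift ord0 i, r) : joined_copies).
  by move=> i j /(congr1 fst)/lift_inj.
have := bounded hub hub_out; rewrite leqNgt => /negP[]; apply: leq_trans DN _.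
rewrite -[X in X <= _]card_ord -(card_imset _ root_inj).
apply/subset_leq_card/subsetP => _ /imsetP[i _ ->]; rewrite inE hub_adj.
exact: forced _ (joined_coloring _ col).
Qed.

End JoinedCopies.

Lemma forced_planar_not_colorable (R : realType) D L (G : sgraph) (r : G) :
  rooted_book r -> cycle_lengths_in G L -> forced_in D r \/ forced_out D r ->
  exists H : sgraph, [/\ planar R H, cycle_lengths_in H L & ~ colorable [tuple 0; D] H].
Proof.
move=> book lengths forced; exists (joined_copies r D.+1); split.
- by have [rho [page [rho_book _]]] := joined_copies_book D.+1 book;
    apply: book_planar rho_book.
- exact: joined_copies_cycle_lengths.
- by case/colorableP=> I; apply: joined_not_colorable.
Qed.

(** * Blown-up cycles *)

Section ParallelPaths.
Variables (D : nat) (G : sgraph) (I : pred G) (T : finType).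
Hypothesis colored : coloring D I.

Lemma card_nbrs_out (w : T -> G) u : injective w -> (forall i, adj u (w i)) -> ~~ I u ->
  #|[pred i | ~~ I (w i)]| <= D.
Proof.
move=> w_inj uw Iu; have [_ bounded] := colored; apply: leq_trans (bounded u Iu).
rewrite -(card_imset _ w_inj); apply/subset_leq_card/subsetP => _ /imsetP[i Ii ->].
by rewrite inE uw.
Qed.

Lemma parallel_2paths_in (w : T -> G) u v : D < #|T| -> injective w ->
  (forall i, adj u (w i)) -> (forall i, adj v (w i)) -> I u -> I v.
Proof.
move=> DT w_inj uw vw Iu; apply: contraTT DT => Iv; rewrite -leqNgt.
have [indep _] := colored; apply: leq_trans (card_nbrs_out w_inj vw Iv).
by apply/subset_leq_card/subsetP => i _; rewrite inE; apply/negP/(indep _ _ (uw i) Iu).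
Qed.

Lemma parallel_3paths_in (a b : T -> G) u v :
  2 * D < #|T| -> injective a -> injective b ->
  (forall i, adj u (a i)) -> (forall i, adj (a i) (b i)) -> (forall i, adj v (b i)) ->
  ~~ I u -> I v.
Proof.
move=> DT a_inj b_inj ua ab vb Iu; apply: contraTT DT => Iv; rewrite -leqNgt.
have [indep _] := colored.
apply: (@leq_trans (#|[pred i | ~~ I (a i)]| + #|[pred i | ~~ I (b i)]|)).
  rewrite -cardUI; apply: leq_trans (leq_addr _ _).
  apply/subset_leq_card/subsetP => i _; rewrite !inE -negb_and.
  by apply/negP => /andP[Ia Ib]; apply: indep (ab i) Ia Ib.
rewrite mul2n -addnn; apply: leq_add; first exact: card_nbrs_out a_inj ua Iu.
exact: card_nbrs_out b_inj vb Iv.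
Qed.

End ParallelPaths.

Section CyclicSteps.
Variable n : nat.

Definition step (d : bool) : 'I_n.+1 -> 'I_n.+1 := if d then @ordS _ else @ord_pred _.

Definition step_nat (d : bool) (p : nat) : nat :=
  if d then (if p == n then 0 else p.+1) else (if p == 0 then n else p.-1).

Lemma step_nat_lt p : p < n -> step_nat true p = p.+1.
Proof. by move=> pn; rewrite /step_nat ltn_eqF. Qed.

Lemma step_nat_last : step_nat true n = 0.
Proof. by rewrite /step_nat eqxx. Qed.

Lemma val_step d p : step d p = step_nat d p :> nat.
Proof.
have p_le := ltn_ord p; case: d => /=.
  case: eqP => [->|ne]; first by rewrite modnn.
  by rewrite modn_small //; lia.
case: eqP => [->|ne]; first by rewrite add0n /= modn_small.
have -> : (p + n.+1).-1 = p.-1 + n.+1 by lia.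
by rewrite modnDr modn_small //; lia.
Qed.

Lemma stepK d : cancel (step d) (step (~~ d)).
Proof. by case: d; [apply: ordSK | apply: ord_predK]. Qed.

Lemma iter_stepK d u : cancel (iter u (step d)) (iter u (step (~~ d))).
Proof. by move=> p; elim: u => // u IH; rewrite iterSr /= stepK. Qed.

Lemma val_iter_step d u p : iter u (step d) p = iter u (step_nat d) p :> nat.
Proof. by elim: u => //= u <-; apply: val_step. Qed.

Lemma val_iter_succ u (p : 'I_n.+1) : iter u (step true) p = (p + u) %% n.+1 :> nat.
Proof.
elim: u => [|u IH]; first by rewrite addn0 modn_small.
by rewrite iterS /= IH addnS -addn1 modnDml addn1.
Qed.

Lemma iter_step_eq d u (p : 'I_n.+1) : (iter u (step d) p == p) = (n.+1 %| u).
Proof.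
have forward q : (iter u (step true) q == q) = (n.+1 %| u).
  rewrite -val_eqE /= val_iter_succ -[X in _ == X](modn_small (ltn_ord q)).
  by rewrite -[X in _ == X %% _]addn0 eqn_modDl mod0n.
case: d; first exact: forward.
by rewrite -(can_eq (iter_stepK true u)) (iter_stepK false) eq_sym forward.
Qed.

Lemma iter_step_reach d (p q : 'I_n.+1) : exists u, iter u (step d) p = q.
Proof.
have forward p' q' : exists u, iter u (step true) p' = q'.
  exists (q' + (n.+1 - p')); apply: val_inj; rewrite /= val_iter_succ.
  by rewrite addnCA subnKC ?modnDr ?modn_small // ltnW.
case: d; first exact: forward.
by have [u <-] := forward q p; exists u; apply: (iter_stepK true).
Qed.

End CyclicSteps.

Section CycleBlowup.
(* A cycle of length [n + 1] whose vertices at the positions in [fat] are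
   replaced by [m + 1] copies; between consecutive fat positions only equal copies
   are adjacent. *)
Variables (n m : nat) (fat : pred nat).

Definition blowup_pred : pred ('I_n.+1 * 'I_m.+1) := fun v => fat v.1 || (v.2 == ord0).
Definition blowup_vertex : finType := {v | blowup_pred v}.

Definition blowup_adj : rel blowup_vertex := fun u v =>
  [&& (val u).1 != (val v).1,
      (ordS (val u).1 == (val v).1) || (ordS (val v).1 == (val u).1) &
      fat (val u).1 && fat (val v).1 ==> ((val u).2 == (val v).2)].

Lemma blowup_adj_sym : symmetric blowup_adj.
Proof.
by move=> u v; rewrite /blowup_adj eq_sym orbC [fat _ && _]andbC [(val u).2 == _]eq_sym.
Qed.

Lemma blowup_adj_irrefl : irreflexive blowup_adj.
Proof. by move=> u; rewrite /blowup_adj eqxx. Qed.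

Definition cycle_blowup : sgraph := SGraph blowup_adj_sym blowup_adj_irrefl.

Fact blowup_root_subproof : blowup_pred (ord0, ord0).
Proof. by rewrite /blowup_pred eqxx orbT. Qed.

Definition blowup_root : cycle_blowup :=
  exist (fun v => blowup_pred v) _ blowup_root_subproof.

Lemma blowup_copy_thin (u : cycle_blowup) : ~~ fat (val u).1 -> (val u).2 = ord0.
Proof. by have := valP u; rewrite /blowup_pred => /orP[->|/eqP]. Qed.

Lemma blowup_eq (u v : cycle_blowup) :
  (val u).1 = (val v).1 -> (val u).2 = (val v).2 -> u = v.
Proof.
by move=> pos_eq copy_eq; apply: val_inj; rewrite [LHS]surjective_pairing pos_eq copy_eq
  -surjective_pairing.
Qed.

Lemma blowup_nbr_unique (u v w : cycle_blowup) : adj u v -> adj u w ->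
  (val v).1 = (val w).1 -> fat (val u).1 || ~~ fat (val v).1 -> v = w.
Proof.
move=> /and3P[_ _ copies_v] /and3P[_ _ copies_w] vw; case: (boolP (fat (val v).1)).
  move=> fat_v; rewrite orbF => fat_u; apply: blowup_eq => //.
  move: copies_v copies_w; rewrite fat_u -vw fat_v.
  by move=> /eqP<- /eqP<-.
by move=> thin_v _; apply: blowup_eq => //; rewrite !blowup_copy_thin // -vw.
Qed.

(* The fat positions come in runs of length [l - 1], which form bundles of paths
   of length [l] between thin positions. *)
Definition bundled (l : nat) : Prop := forall d p, p <= n ->
  ~~ fat p -> fat (step_nat n d p) ->
  (forall i, 0 < i < l -> fat (iter i (step_nat n d) p)) /\
  ~~ fat (iter l (step_nat n d) p).

Section BlowupWalk.
Variables (k : nat) (f : nat -> cycle_blowup).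
Hypotheses (thin0 : ~~ fat 0) (k3 : 3 <= k) (walk : cycle_walk k f).

Let pos t : 'I_n.+1 := (val (f t)).1.
Let dir t := ordS (pos t) == pos t.+1.

Let walk_adj t : adj (f t) (f t.+1). Proof. by case: walk. Qed.

Lemma walk_eqD t u : (f (t + u) == f t) = (k %| u).
Proof. by have [_ ->] := walk; rewrite -[X in _ == X %% _]addn0 eqn_modDl mod0n. Qed.

Lemma walk_period t i : f (t + i * k) = f t.
Proof. by apply/eqP; rewrite walk_eqD dvdn_mull. Qed.

Lemma pos_succ t : pos t.+1 = step (dir t) (pos t).
Proof.
rewrite /dir; case: eqP => [//|not_succ].
have /and3P[_ /orP[/eqP//|/eqP pred_t] _] := walk_adj t.
have -> : pos t = step true (pos t.+1) by apply: esym pred_t.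
exact: esym (stepK true _).
Qed.

Lemma pos_pred t : pos t = step (~~ dir t) (pos t.+1).
Proof. by rewrite pos_succ stepK. Qed.

Lemma walk_not_back t : f t.+2 != f t.
Proof. by rewrite -addn2 walk_eqD; apply/negP => /dvdn_leq; lia. Qed.

Lemma dir_flip t : dir t.+1 != dir t -> fat (pos t) && ~~ fat (pos t.+1).
Proof.
move=> flip; apply: contraT => not_end; have /eqP[] := walk_not_back t.
have back : dir t.+1 = ~~ dir t by case: (dir t.+1) (dir t) flip => [] [].
have pos_back : pos t.+2 = pos t by rewrite pos_succ back -pos_pred.
apply: (@blowup_nbr_unique (f t.+1)); rewrite // ?[adj _ (f t)]adj_sym //.
by rewrite -/(pos t.+1) -/(pos t.+2) pos_back; rewrite negb_and negbK orbC in not_end.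
Qed.

Lemma dir_fat t : fat (pos t.+1) -> dir t.+1 = dir t.
Proof. by move=> fat_t; apply: contraTeq fat_t => /dir_flip/andP[]. Qed.

Lemma walk_thin_eq t u : pos t = pos u -> ~~ fat (pos t) -> f t = f u.
Proof.
move=> tu thin; apply: blowup_eq => //.
by rewrite !blowup_copy_thin // -/(pos u) -tu.
Qed.

Lemma pos_run d t u : (forall i, i < u -> dir (t + i) = d) ->
  pos (t + u) = iter u (step d) (pos t).
Proof.
elim: u => [|u IH] run; first by rewrite addn0.
by rewrite addnS pos_succ run // IH // => i iu; apply/run/ltnW.
Qed.

Lemma walk_constant_dir : (forall t, dir t.+1 = dir t) -> k = n.+1.
Proof.
move=> dir_const; have run t u : pos (t + u) = iter u (step (dir 0)) (pos t).
  by apply: pos_run => i _; elim: (t + i) => // j <-.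
have [t0 t0_pos] := iter_step_reach (dir 0) (pos 0) ord0.
rewrite -(run 0) add0n in t0_pos; apply/eqP; rewrite eqn_dvd.
rewrite -(iter_step_eq (dir 0) k (pos t0)) -run; apply/andP; split; last first.
  by apply/eqP; rewrite /pos; congr (val _).1; apply/eqP; rewrite walk_eqD.
rewrite -(walk_eqD t0); apply/eqP/walk_thin_eq; last first.
  by rewrite run; have /eqP-> : iter n.+1 (step (dir 0)) (pos t0) == pos t0;
    rewrite ?iter_step_eq // t0_pos.
by apply/eqP; rewrite run iter_step_eq.
Qed.

(* A walk that turns around at a thin position after a bundle has come through the
   whole bundle, and goes back to the other end of the bundle. *)
Lemma walk_turn l t : bundled l.+1 -> dir (t + l).+1 != dir (t + l) ->
  f (t + 2 * l.+1) = f t /\ (k %| l.+1) = (n.+1 %| l.+1).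
Proof.
set p := pos (t + l).+1; set e := dir (t + l).+1 => bundles turn.
have /andP[fat_before thin_p] := dir_flip turn; rewrite -/p in thin_p.
have dir_before : dir (t + l) = ~~ e by case: e (dir (t + l)) turn => [] [].
have pos_before : pos (t + l) = step e p by rewrite pos_pred dir_before negbK.
rewrite pos_before val_step in fat_before.
have p_le : p <= n by rewrite -ltnS; apply: ltn_ord.
have [fat_bundle thin_end] := bundles e p p_le thin_p fat_before.
have before i : i <= l ->
    dir (t + (l - i)) = ~~ e /\ pos (t + (l - i)) = iter i.+1 (step e) p.
  elim: i => [|i IH] il; first by rewrite subn0.
  have [dir_i pos_i] := IH (ltnW il).
  have next : t + (l - i) = (t + (l - i.+1)).+1 by lia.
  rewrite next in dir_i pos_i; have dir_i1 : dir (t + (l - i.+1)) = ~~ e.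
    by rewrite -dir_i; apply/esym/dir_fat; rewrite pos_i val_iter_step;
      apply: fat_bundle.
  by rewrite pos_pred dir_i1 negbK pos_i.
have after i : i <= l ->
    dir ((t + l).+1 + i) = e /\ pos ((t + l).+1 + i) = iter i (step e) p.
  elim: i => [|i IH] il; first by rewrite addn0.
  have [dir_i pos_i] := IH (ltnW il).
  have pos_i1 : pos ((t + l).+1 + i).+1 = iter i.+1 (step e) p.
    by rewrite pos_succ dir_i pos_i.
  by rewrite addnS; split=> //; rewrite dir_fat // pos_i1 val_iter_step;
    apply: fat_bundle.
have [_] := before l (leqnn l); rewrite subnn addn0 => pos_t.
have thin_t : ~~ fat (pos t) by rewrite pos_t val_iter_step.
split.
  have -> : t + 2 * l.+1 = ((t + l).+1 + l).+1 by lia.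
  have [dir_l pos_l] := after l (leqnn l).
  by apply/esym/walk_thin_eq; rewrite // pos_t -/(pos _) pos_succ dir_l pos_l.
have tl : t + l.+1 = (t + l).+1 by rewrite addnS.
rewrite -(walk_eqD t) -(iter_step_eq e l.+1 p) -pos_t tl;
  apply/eqP/eqP => [returns|pos_eq].
  by rewrite /p /pos returns.
exact/esym/walk_thin_eq.
Qed.

Lemma blowup_walk_length l : bundled l.+1 ->
  k = n.+1 \/ (k %| 2 * l.+1 /\ (k %| l.+1) = (n.+1 %| l.+1)).
Proof.
move=> bundles.
have [/walk_constant_dir|/existsNP[t0 /eqP turn]] :=
  pselect (forall t, dir t.+1 = dir t).
  by left.
have dir_period t : dir (t + l * k) = dir t by rewrite /dir /pos -!addSn !walk_period.
have tE : t0 + l * k = (t0 + l * k.-1) + l by rewrite -addnA -mulnSr prednK //; lia.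
right; rewrite -(walk_eqD (t0 + l * k.-1)).
have [|returns ->] := @walk_turn l (t0 + l * k.-1) bundles;
  last by rewrite returns eqxx.
by rewrite -tE -addSn !dir_period.
Qed.

End BlowupWalk.

Section BlowupBook.
Hypotheses (n_even : ~~ odd n) (n_ge2 : 2 <= n) (thin0 : ~~ fat 0).

Let level (u : cycle_blowup) : nat := (val u).1.
Let copy (u : cycle_blowup) : nat := (val u).2.

(* Copies are listed in opposite orders at consecutive positions, so that equal
   copies are nested. *)
Definition spine (u : cycle_blowup) : nat :=
  level u * m.+1 + (if odd (level u) then m - copy u else copy u).

Definition spine_page (u v : cycle_blowup) : bool := odd (minn (level u) (level v)).

Lemma level_le u : level u <= n. Proof. by rewrite -ltnS; apply: ltn_ord. Qed.
Lemma copy_le u : copy u <= m. Proof. by rewrite -ltnS; apply: ltn_ord. Qed.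

Lemma spine_level u : spine u %/ m.+1 = level u.
Proof.
rewrite divnMDl // divn_small ?addn0 //.
by case: odd; rewrite ltnS ?leq_subr ?copy_le.
Qed.

Lemma spine_lt_level u v : spine u < spine v -> level u <= level v.
Proof. by move=> /ltnW/(leq_div2r m.+1); rewrite !spine_level. Qed.

Lemma spine_lt_same_level u v : level u = level v ->
  (spine u < spine v) = if odd (level v) then copy v < copy u else copy u < copy v.
Proof.
move=> same; rewrite /spine same ltn_add2l.
by have := copy_le u; have := copy_le v; case: odd => //; lia.
Qed.

Lemma spine_inj : injective spine.
Proof.
move=> u v spine_uv; have same : level u = level v by rewrite -!spine_level spine_uv.
apply: blowup_eq; apply: ord_inj => //; move: spine_uv; rewrite /spine same => /addnI.
by have := copy_le u; have := copy_le v; rewrite -/(copy u) -/(copy v);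
  case: odd => //; lia.
Qed.

Lemma thin_copy u : ~~ fat (level u) -> copy u = 0.
Proof. by move=> thin; rewrite /copy blowup_copy_thin. Qed.

Lemma adj_level u v : adj u v -> level u <= level v ->
  level v = (level u).+1 \/ (level u = 0 /\ level v = n).
Proof.
have succ (w w' : cycle_blowup) : ordS (val w).1 == (val w').1 ->
    level w' = (level w).+1 \/ (level w = n /\ level w' = 0).
  move=> /eqP/(congr1 (@nat_of_ord _))/=; rewrite -/(level w) -/(level w') => <-.
  case: (ltngtP (level w) n) (level_le w) => // [lt|->] _; last by right; rewrite modnn.
  by left; rewrite modn_small.
case/and3P=> _ /orP[] /succ[] next _ uv; lia.
Qed.

Lemma same_level_nested x y z w : adj x y -> adj z w ->
  level z = level x -> level y = (level x).+1 -> level w = (level z).+1 ->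
  spine x < spine z -> spine w <= spine y.
Proof.
move=> axy azw zx yx wz; have wy : level w = level y by rewrite wz yx zx.
rewrite [spine w <= _]leqNgt !spine_lt_same_level // wy yx zx /=.
have same_copy (u v : cycle_blowup) : adj u v -> fat (level u) -> fat (level v) ->
    copy u = copy v.
  by case/and3P=> _ _ /implyP copies fat_u fat_v; rewrite /copy (eqP (copies _)) //
    -/(level u) -/(level v) fat_u.
have [fat_x|thin_x] := boolP (fat (level x)); last first.
  by rewrite (@thin_copy x) // (@thin_copy z) ?zx // ltnn if_same.
have [fat_y|thin_y] := boolP (fat (level y)); last first.
  by rewrite (@thin_copy y) // (@thin_copy w) ?wy // ltnn if_same.
rewrite (same_copy x y) // (same_copy z w) ?zx ?wy //.
by case: (odd (level x)) => /= lt; rewrite -leqNgt ltnW.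
Qed.

Lemma blowup_book : rooted_book blowup_root.
Proof.
exists spine, spine_page; split; last by move=> u; rewrite /spine /level /= mul0n.
split=> [|u v|x y z w axy azw xz zy yw]; first exact: spine_inj.
  by rewrite /spine_page minnC.
have := level_le w; have := spine_lt_level xz; have := spine_lt_level zy.
have := spine_lt_level yw; rewrite /spine_page => yw_le zy_le xz_le w_le.
have level0 u v : level u = 0 -> level v = 0 -> spine u < spine v -> False.
  move=> u0 v0; rewrite spine_lt_same_level ?u0 ?v0 //=.
  by rewrite !thin_copy // ?u0 ?v0.
have [yE|[x0 yn]] := adj_level axy (leq_trans xz_le zy_le);
  have [wE|[z0 wn]] := adj_level azw (leq_trans zy_le yw_le).
- have [zx _|zx] := eqVneq (level z) (level x).
    by have := same_level_nested axy azw zx yE wE xz; rewrite leqNgt yw.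
  by rewrite !minnE; lia.
- by case: (level0 x z) => //; lia.
- by rewrite !minnE; lia.
- by case: (level0 x z).
Qed.

End BlowupBook.

Definition blowup_at (p : nat) (a : 'I_m.+1) : cycle_blowup :=
  insubd blowup_root (inord p, a).

Lemma val_blowup_at p a :
  p <= n -> fat p || (a == ord0) -> val (blowup_at p a) = (inord p, a).
Proof. by move=> pn ok; rewrite /blowup_at val_insubd /blowup_pred inordK // ok. Qed.

Lemma blowup_at0 : blowup_at 0 ord0 = blowup_root.
Proof.
apply: val_inj; rewrite val_blowup_at ?eqxx ?orbT //=; congr (_, _).
by apply: val_inj; rewrite /= inordK.
Qed.

Lemma blowup_at_inj p : p <= n -> fat p -> injective (blowup_at p).
Proof.
by move=> pn fat_p a b /(congr1 (fun u : cycle_blowup => val u));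
  rewrite !val_blowup_at ?fat_p // => -[].
Qed.

Lemma blowup_at_adj p q a b : 0 < n -> p <= n -> step_nat n true p = q ->
  fat p || (a == ord0) -> fat q || (b == ord0) -> (fat p -> fat q -> a = b) ->
  adj (blowup_at p a) (blowup_at q b).
Proof.
move=> n_gt0 pn <- copy_a copy_b ab; have qn : step_nat n true p <= n.
  by rewrite /step_nat; case: eqP => // ne; rewrite ltn_neqAle pn andbT; apply/eqP.
rewrite [adj _ _]/(blowup_adj _ _) /blowup_adj !val_blowup_at //= !inordK //.
have -> : inord (step_nat n true p) = ordS (inord p) :> 'I_n.+1.
  apply: val_inj; rewrite [LHS]inordK //.
  by rewrite -[RHS]/(step true (inord p) : nat) val_step inordK.
rewrite eqxx /=; apply/andP; split; last first.
  by apply/implyP => /andP[fat_p fat_q]; rewrite ab.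
rewrite eq_sym -[ordS _]/(iter 1 (step true) _) iter_step_eq dvdn1.
by rewrite eqSS -lt0n.
Qed.

Section BlowupColoring.
Variables (D : nat) (I : pred cycle_blowup).
Hypotheses (n_gt0 : 0 < n) (colored : coloring D I).

Let x p := blowup_at p ord0.

Lemma blowup_edge_out p q : p <= n -> step_nat n true p = q -> ~~ (fat p && fat q) ->
  I (x p) -> ~~ I (x q).
Proof.
move=> pn pq thin Ip; apply/negP => Iq; have [indep _] := colored; apply: indep Ip Iq.
by apply: blowup_at_adj; rewrite ?eqxx ?orbT // => fat_p fat_q;
  rewrite fat_p fat_q in thin.
Qed.

Lemma blowup_2bundle_in p q s : D <= m -> p <= n -> q <= n ->
  step_nat n true p = q -> step_nat n true q = s ->
  ~~ fat p -> fat q -> ~~ fat s -> I (x p) -> I (x s).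
Proof.
move=> Dm pn qn pq qs thin_p fat_q thin_s.
apply: (parallel_2paths_in colored (w := blowup_at q)) => [||a|a].
- by rewrite card_ord ltnS.
- exact: blowup_at_inj.
- by apply: blowup_at_adj; rewrite ?fat_q ?eqxx ?orbT // (negPf thin_p).
- by rewrite adj_sym; apply: blowup_at_adj;
    rewrite ?fat_q ?eqxx ?orbT // (negPf thin_s).
Qed.

Lemma blowup_3bundle_in p q r s : 2 * D <= m -> p <= n -> q <= n -> r <= n ->
  step_nat n true p = q -> step_nat n true q = r -> step_nat n true r = s ->
  ~~ fat p -> fat q -> fat r -> ~~ fat s -> ~~ I (x p) -> I (x s).
Proof.
move=> Dm pn qn rn pq qr rs thin_p fat_q fat_r thin_s.
apply: (parallel_3paths_in colored (a := blowup_at q) (b := blowup_at r)) => [|||a|a|a].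
- by rewrite card_ord ltnS.
- exact: blowup_at_inj.
- exact: blowup_at_inj.
- by apply: blowup_at_adj; rewrite ?fat_q ?eqxx ?orbT // (negPf thin_p).
- by apply: blowup_at_adj; rewrite ?fat_q ?fat_r.
- by rewrite adj_sym; apply: blowup_at_adj;
    rewrite ?fat_r ?eqxx ?orbT // (negPf thin_s).
Qed.

End BlowupColoring.

End CycleBlowup.

(** * Minimal obstruction sets *)

Section OddBlowup.
Variables (D i : nat).
Hypothesis i_gt0 : 0 < i.

Lemma odd_bundled : bundled (2 * i) odd 2.
Proof.
move=> d p p_le p_even step_odd; split; first by case=> [|[|]].
case: d step_odd; rewrite /= /step_nat.
  by case: (eqVneq p (2 * i)) => //= _; case: (eqVneq p.+1 (2 * i)) => /=; lia.
case: (eqVneq p 0) => [_|p_neq0] /=; first by lia.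
by case: (eqVneq p.-1 0) => /=; lia.
Qed.

Lemma odd_blowup_cycle_lengths m :
  cycle_lengths_in (cycle_blowup (2 * i) m odd) (fun k => k = 2 * i + 1 \/ k = 4).
Proof.
move=> k f k3 walk; rewrite addn1.
have [|[k_dvd4 k_dvd2]] := blowup_walk_length (isT : ~~ odd 0) k3 walk odd_bundled;
  first by left.
right; have : k <= 4 by apply: dvdn_leq k_dvd4.
by case: k k3 k_dvd4 {walk k_dvd2} => [|[|[|[|[|]]]]].
Qed.

(* Otherwise all even positions, hence both ends of the closing edge, would lie in
   the independent part. *)
Lemma odd_blowup_forced_out m : D <= m -> forced_out D (blowup_root (2 * i) m odd).
Proof.
move=> Dm I colored; apply/negP; rewrite -blowup_at0 => I0.
have n_gt0 : 0 < 2 * i by lia.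
have I_even j : j <= i -> I (blowup_at (2 * i) odd (2 * j) ord0).
  elim: j => [|j IH] ji; first by rewrite muln0.
  apply: (blowup_2bundle_in n_gt0 colored Dm (q := (2 * j).+1)) (IH (ltnW ji)); try lia.
    by apply: step_nat_lt; lia.
  by rewrite step_nat_lt; lia.
have := blowup_edge_out n_gt0 colored (leqnn _) (step_nat_last _) _
  (I_even i (leqnn i)).
by rewrite I0 andbF => /(_ isT).
Qed.

Lemma odd_blowup_book m : rooted_book (blowup_root (2 * i) m odd).
Proof. by apply: blowup_book; lia. Qed.

End OddBlowup.

(* Bundles of paths of length 3 separated by single edges; the root, at position 0,
   is between two single edges if [c = 0], and between two bundles if [c = 1]. *)
Definition fat_pairs (c : nat) : pred nat := fun p => (p + c) %% 4 \in [:: 2; 3].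

Section PairBlowup.
Variables (n c : nat).
Hypotheses (n_gt0 : 0 < n) (c_le1 : c <= 1) (n_mod4 : n %% 4 = 2 * c).

Lemma fat_pairs_bundled : bundled n (fat_pairs c) 3.
Proof.
move=> d p p_le thin_p fat_step.
suff [fat_step2 thin_step3] : fat_pairs c (iter 2 (step_nat n d) p) /\
    ~~ fat_pairs c (iter 3 (step_nat n d) p) by split=> // -[|[|[|]]].
move: thin_p fat_step; rewrite /fat_pairs /= !inE /step_nat; case: d.
  case: (eqVneq p n) => [->|_] /=; first by lia.
  case: (eqVneq p.+1 n) => [?|_] /=; first by lia.
  by case: (eqVneq p.+2 n) => [?|_] /=; lia.
case: (eqVneq p 0) => [->|_] /=.
  case: (eqVneq n 0) => [?|_] /=; first by lia.
  by case: (eqVneq n.-1 0) => [?|_] /=; lia.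
case: (eqVneq p.-1 0) => [?|_] /=; first by lia.
by case: (eqVneq p.-2 0) => [?|_] /=; lia.
Qed.

Lemma pair_blowup_cycle_lengths m : 1 < n ->
  cycle_lengths_in (cycle_blowup n m (fat_pairs c))
                   (fun k => k = n.+1 \/ k = 6 /\ 2 < n).
Proof.
move=> n_gt1 k f k3 walk; have thin0 : ~~ fat_pairs c 0 by rewrite /fat_pairs !inE; lia.
have [|[k_dvd6 k_dvd3]] := blowup_walk_length thin0 k3 walk fat_pairs_bundled;
  first by left.
have k_le : k <= 6 by apply: dvdn_leq k_dvd6.
have k36 : k = 3 \/ k = 6.
  by case: k k3 k_dvd6 k_le {walk k_dvd3} => [|[|[|[|[|[|[|]]]]]]] //; auto.
have [n2|n_neq2] := eqVneq n 2.
  by left; rewrite n2 in k_dvd3 *; case: k36 k_dvd3 => ->.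
right; split; last by lia.
by case: k36 k_dvd3 => // -> /esym/dvdn_leq; lia.
Qed.

Lemma pair_blowup_book m : ~~ odd n -> 1 < n ->
  rooted_book (blowup_root n m (fat_pairs c)).
Proof. by move=> n_even n_gt1; apply: blowup_book; rewrite // /fat_pairs !inE; lia. Qed.

End PairBlowup.

Section PairBlowupColoring.
Variables (D n m c : nat) (I : pred (cycle_blowup n m (fat_pairs c))).
Hypotheses (n_gt0 : 0 < n) (Dm : 2 * D <= m) (colored : coloring D I).

Let x p := blowup_at n (fat_pairs c) p (ord0 : 'I_m.+1).

Lemma pair_edge_out p : p < n -> (p + c) %% 4 = 0 -> I (x p) -> ~~ I (x p.+1).
Proof.
move=> pn p_mod; apply: (blowup_edge_out n_gt0 colored (ltnW pn) (step_nat_lt pn)).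
by rewrite /fat_pairs p_mod.
Qed.

Lemma pair_bundle_in p q : p.+2 <= n -> step_nat n true p.+2 = q -> (p + c) %% 4 = 1 ->
  ~~ fat_pairs c q -> ~~ I (x p) -> I (x q).
Proof.
move=> pn pq p_mod thin_q; have pn1 : p < n by apply: ltnW.
apply: (blowup_3bundle_in n_gt0 colored Dm (ltnW pn1) pn1 pn (step_nat_lt pn1)
  (step_nat_lt pn) pq _ _ _ thin_q); rewrite /fat_pairs ?inE; lia.
Qed.

End PairBlowupColoring.

Lemma pair_blowup_forced_out D j m : 0 < j -> 2 * D <= m ->
  forced_out D (blowup_root (4 * j) m (fat_pairs 0)).
Proof.
move=> j_gt0 Dm I colored; apply/negP; rewrite -blowup_at0 => I0.
have n_gt0 : 0 < 4 * j by lia.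
have I_mul4 t : t <= j -> I (blowup_at (4 * j) (fat_pairs 0) (4 * t) ord0).
  elim: t => [|t IH] tj; first by rewrite muln0.
  have -> : 4 * t.+1 = (4 * t).+1.+3 by lia.
  apply: (pair_bundle_in n_gt0 Dm colored (p := (4 * t).+1)); try lia.
  - by rewrite step_nat_lt //; lia.
  - by rewrite /fat_pairs !inE; lia.
  by apply: (pair_edge_out n_gt0 colored) (IH (ltnW tj)); lia.
have := blowup_edge_out n_gt0 colored (leqnn _) (step_nat_last _) _
  (I_mul4 j (leqnn j)).
by rewrite I0 andbF => /(_ isT).
Qed.

Lemma pair_blowup_forced_in D j m : 2 * D <= m ->
  forced_in D (blowup_root (4 * j + 2) m (fat_pairs 1)).
Proof.
move=> Dm I colored; apply: contraT; rewrite -blowup_at0 => I0.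
have n_gt0 : 0 < 4 * j + 2 by lia.
have I_mul4 t : t <= j -> ~~ I (blowup_at (4 * j + 2) (fat_pairs 1) (4 * t) ord0).
  elim: t => [|t IH] tj; first by rewrite muln0.
  have -> : 4 * t.+1 = (4 * t).+3.+1 by lia.
  apply: (pair_edge_out n_gt0 colored); [lia | lia|].
  apply: (pair_bundle_in n_gt0 Dm colored) (IH (ltnW tj)); try lia.
  - by rewrite step_nat_lt //; lia.
  - by rewrite /fat_pairs !inE; lia.
case/negP: I0; apply: (pair_bundle_in n_gt0 Dm colored) (I_mul4 j (leqnn j)) => //;
  try lia.
have -> : (4 * j).+2 = 4 * j + 2 by lia.
exact: step_nat_last.
Qed.

Lemma odd_4_gadget (R : realType) D i : 0 < i -> exists H : sgraph,
  [/\ planar R H, cycle_lengths_in H (fun k => k = 2 * i + 1 \/ k = 4) &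
      ~ colorable [tuple 0; D] H].
Proof.
move=> i_gt0; apply: (forced_planar_not_colorable R (r := blowup_root (2 * i) D odd)).
- exact: odd_blowup_book.
- exact: odd_blowup_cycle_lengths.
- by right; apply: odd_blowup_forced_out.
Qed.

Lemma odd_6_gadget (R : realType) D i : 0 < i -> exists H : sgraph,
  [/\ planar R H, cycle_lengths_in H (fun k => k = 2 * i + 1 \/ k = 6 /\ 1 < i) &
      ~ colorable [tuple 0; D] H].
Proof.
move=> i_gt0; pose c : nat := odd i; pose n := 2 * i.
have c_le1 : c <= 1 by rewrite /c; case: odd.
have n_mod4 : n %% 4 = 2 * c by rewrite /n /c; lia.
apply: (forced_planar_not_colorable R (r := blowup_root n (2 * D) (fat_pairs c))).
- by apply: pair_blowup_book; rewrite // /n; lia.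
- move=> k f k3 walk.
  have [||->|[-> n_gt2]] := pair_blowup_cycle_lengths _ c_le1 n_mod4 _ k3 walk;
    rewrite /n.
  + lia.
  + lia.
  + by left; lia.
  + by right; split=> //; move: n_gt2; rewrite /n; lia.
rewrite /n /c; case: (boolP (odd i)) => i_odd.
  have -> : 2 * i = 4 * i./2 + 2 by lia.
  by left; apply: pair_blowup_forced_in.
have -> : 2 * i = 4 * i./2 by lia.
by right; apply: pair_blowup_forced_out; lia.
Qed.

Local Open Scope classical_set_scope.

Lemma obstruction_set_meets (R : realType) (X : set nat) (L : nat -> Prop) :
  cycle_obstruction_set R X ->
  (forall D, exists H : sgraph,
     [/\ planar R H, cycle_lengths_in H L & ~ colorable [tuple 0%N; D] H]) ->
  exists k, X k /\ L k.
Proof.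
case=> X_ge3 [D X_colorable] gadget; have [H [planarH lengths uncolorable]] := gadget D.
apply: contrapT => disjoint; apply: uncolorable; apply: X_colorable => // k Xk sub.
have k3 : (3 <= k)%N by apply: X_ge3.
have [f walk] := subgraph_cycle_walk k3 sub.
by apply: disjoint; exists k; split=> //; apply: lengths walk.
Qed.

Lemma odd_obstruction_set (R : realType) :
  cycle_obstruction_set R [set (2 * i + 1)%N | i in [set i : nat | (1 <= i)%N]].
Proof.
split=> [_ [i /= i_ge1 <-] /=|]; first by lia.
exists 0%N => G _ no_odd; apply/colorableP/no_odd_cycle_coloring => i i_ge1.
by apply: no_odd; exists i.
Qed.

Lemma three_four_six_obstruction_set (R : realType) :
  cycle_obstruction_set R [set k : nat | k = 3%N \/ k = 4%N \/ k = 6%N].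
Proof.
split=> [k /= [->|[->|->]]//|]; exists 40%N => G planarG no346; apply/colorableP.
by apply: (planar_no346_coloring (R := R)); split=> //; apply: no346; rewrite /=; auto.
Qed.

Lemma obstruction_set_superset (R : realType) (X : set nat) :
  cycle_obstruction_set R X ->
  [set (2 * i + 1)%N | i in [set i : nat | (1 <= i)%N]] `<=` X \/
  [set k : nat | k = 3%N \/ k = 4%N \/ k = 6%N] `<=` X.
Proof.
move=> obsX; have meets L := @obstruction_set_meets R X L obsX.
have X3 : X 3%N.
  by have [k [Xk [kE|[_ //]]]] := meets _ (fun D => @odd_6_gadget R D 1 isT);
    rewrite kE in Xk.
apply: contrapT => /not_orP[/existsNP[l /not_implyP[[i /= i_gt0 <-] not_odd]]].
apply=> _ [->|[->|->]] //.
  by have [k [Xk [kE|<-//]]] := meets _ (fun D => odd_4_gadget R D i_gt0);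
    rewrite kE in Xk.
by have [k [Xk [kE|[<-//]]]] := meets _ (fun D => odd_6_gadget R D i_gt0);
  rewrite kE in Xk.
Qed.

Theorem theorem3p1 (R : realType) (X : set nat) :
  minimal_cycle_obstruction_set R X <->
  X = [set (2 * i + 1)%N | i in [set i : nat | (1 <= i)%N]] \/
  X = [set k : nat | k = 3%N \/ k = 4%N \/ k = 6%N].
Proof.
split=> [[obsX minX]|[]->].
- case: (obstruction_set_superset obsX) => sub; [left|right]; apply/esym/minX => //.
    exact: odd_obstruction_set.
  exact: three_four_six_obstruction_set.
- split; first exact: odd_obstruction_set.
  move=> Y sub obsY; apply/seteqP; split=> //.
  case: (obstruction_set_superset obsY) => // sub346.
  have [|i _ even4] := sub 4%N; first by apply: sub346; right; left.
  by exfalso; lia.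
- split; first exact: three_four_six_obstruction_set.
  move=> Y sub obsY; apply/seteqP; split=> //.
  case: (obstruction_set_superset obsY) => // sub_odd.
  have Y5 : Y 5%N by apply: sub_odd; exists 2%N.
  by case: (sub _ Y5) => [//|[//|//]].
Qed.
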